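(* Let $f(x)=x^4+ax^2+bx+c\in\mathbb{Z}[x]$ be irreducible, $\theta$ a root of $f(x)$ in an algebraic closure of $\mathbb{Q}$, $K=\mathbb{Q}(\theta)$, and $\Delta=v_3(\operatorname{disc}(f))$. Suppose $a\equiv3\pmod 9$, $3\nmid b$, $3\mid c$. Let $s_0$ be an integer such that $v_3(f''(s_0)/2)=v_3(a+6s_0^2)>\Delta/6$ and $s_0\equiv-b\pmod3$. Denote $u_0=v_3(f(s_0))$, $u_1=v_3(f'(s_0))$, $\sigma_0=f(s_0)/3^{u_0}$. (1) The integer $s_0$ is irregular if and only if $2u_0<3u_1$ and $3\mid u_0$. (2) If $s_0$ is regular, take $s=s_0$. If $s_0$ is irregular, take $s_1=s_0+y\,3^{u_0/3}$, where $y=1$ if $\sigma_0\equiv b\pmod 3$ and $y=-1$ otherwise; if $s_1$ is regular, take $s=s_1$; if $s_1$ is irregular, apply to $s_1$ the iteration method to obtain a regular $s$. Then a $3$-integral basis of $K$ is $$1,\quad \theta,\quad \frac{\theta^2+2s\theta+3s^2+a}{3^{\nu_2}},\quad \frac{\theta^3+s\theta^2+(s^2+a)\theta+s^3+as+b}{3^{\nu_1}},$$ with $\nu_1,\nu_2$ given by: (a) if $2u_0\ge3u_1$: $\nu_1=u_1$, $\nu_2=\lfloor u_1/2\rfloor$; (b) if $2u_0<3u_1$ and $3\nmid u_0$: $\nu_1=\lfloor 2u_0/3\rfloor$, $\nu_2=\lfloor u_0/3\rfloor$; (c) if $2u_0<3u_1$, $3\mid u_0$ and $v_3(f(s_1))=u_0+1$: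 $\nu_1=2u_0/3$, $\nu_2=u_0/3$; (d) if $2u_0<3u_1$, $3\mid u_0$, $v_3(f(s_1))>u_0+1$ and $v_3(f'(s_1))=(2u_0/3)+1$: $\nu_1=(2u_0/3)+1$, $\nu_2=u_0/3$; (e) if $2u_0<3u_1$, $3\mid u_0$, $v_3(f(s_1))=u_0+2$ and $v_3(f'(s_1))>(2u_0/3)+1$: $\nu_1=(2u_0/3)+1$, $\nu_2=u_0/3$; (f) if $2u_0<3u_1$, $3\mid u_0$, $v_3(f(s_1))>u_0+2$ and $v_3(f'(s_1))>(2u_0/3)+1$: $\nu_1=\lfloor\Delta/2\rfloor-(u_0/3)-1$, $\nu_2=(u_0/3)+1$.
   Context: $v_3$ is the $3$-adic valuation, $v_3(0)=\infty$. A $3$-integral basis of $K$ is a family of elements of $K$ that is a $\mathbb{Z}_{(3)}$-basis of $\mathbb{Z}_K\otimes_{\mathbb{Z}}\mathbb{Z}_{(3)}$, where $\mathbb{Z}_K$ is the ring of integers of $K$ and $\mathbb{Z}_{(3)}$ the localization of $\mathbb{Z}$ at $3$. Regular integers (with $p=3$). For $s\in\mathbb{Z}$ write $f(x)=\sum_{i=0}^4 A_i(x-s)^i$, $A_i=f^{(i)}(s)/i!\in\mathbb{Z}$, and $w_i=v_p(A_i)$. Let $N^-_{x-s}(f)$ be the union of the sides of negative slope of the lower convex envelope of the points $(i,w_i)$, $0\le i\le4$, $w_i<\infty$. For an integer abscissa $i$ put $c_i=\overline{A_i/p^{w_i}}\in\mathbb{F}_p$ if $(i,w_i)$ lies on $N^-_{x-s}(f)$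 and $c_i=0$ otherwise. A side of slope $-h/e$ ($h,e$ positive coprime), initial abscissa $i_0$ and horizontal length $de$ has residual polynomial $c_{i_0}+c_{i_0+e}y+\cdots+c_{i_0+de}y^d\in\mathbb{F}_p[y]$. The integer $s$ is regular if the residual polynomials of all sides of $N^-_{x-s}(f)$ are separable, and irregular otherwise. Iteration method. At an irregular integer $s$ (in the present situation) there is a unique side of $N^-_{x-s}(f)$ whose residual polynomial is inseparable; its slope is $-\mu$ with $\mu$ a positive integer, and its residual polynomial has a unique multiple root, which lies in $\mathbb{F}_p$. Choose any integer $y$ reducing to this root and replace $s$ by $s+yp^{\mu}$. Repeat this step until a regular integer is obtained; this happens after finitely many steps. *)

(* Defs.v *)
From HB Require Import structures.
From mathcomp Require Export all_boot all_order all_algebra all_field.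
From mathcomp Require Export constructive_ereal.

Set Implicit Arguments.
Unset Strict Implicit.
Unset Printing Implicit Defensive.

Import Order.TTheory GRing.Theory Num.Theory.
Local Open Scope ring_scope.

Definition v3 (n : int) : \bar rat :=
  if n == 0 then +oo%E else (logn 3 `|n|%N)%:R%:E.

(* The usual normalization; the division by the leading coefficient is exact. *)
Definition disc (f : {poly int}) : int :=
  ((-1) ^+ 'C((size f).-1, 2) * resultant f f^`() %/ lead_coef f)%Z.

Section Integers3.
Variable K : fieldExtType rat.

Definition Z_3 : pred rat := fun q => ~~ (3 %| denq q)%Z.

(* The image in K of the (injective) map O_K (x) Z_(3) -> K. *)
Definition integral3 (x : K) : Prop :=
  exists2 m : int, ~~ (3 %| m)%Z & integralOver (intr : int -> K) (m%:~R * x).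

Definition integral_basis3 (n : nat) (w : n.-tuple K) : Prop :=
  (forall i : 'I_n, integral3 (tnth w i)) /\
  (forall x : K, integral3 x ->
     exists! k : {ffun 'I_n -> rat},
       (forall i, k i \in Z_3) /\ x = \sum_(i < n) k i *: tnth w i).
End Integers3.

Section Polygon.
Variables (f : {poly int}) (s : int).

(* f^`N(i) is the i-th derivative divided by i!. *)
Definition taylor_coef (i : nat) : int := f^`N(i).[s].

(* Only meaningful when taylor_coef i != 0; the points with infinite ordinate
   are discarded explicitly below. *)
Definition ordinate (i : nat) : nat := logn 3 `|taylor_coef i|%N.

(* Ordinate at abscissa x of the line through the points of abscissae i and j. *)
Definition chord (i j x : nat) : rat :=
  (ordinate i)%:R
  + ((ordinate j)%:R - (ordinate i)%:R) / (j%:R - i%:R) * (x%:R - i%:R).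

(* A side of the lower convex envelope is a one-dimensional face: no point lies
   below the line of the side, and no point outside the abscissae i..j lies on
   it, so that the segment is the whole face. *)
Definition is_side (i j : nat) : bool :=
  [&& (i < j)%N, taylor_coef i != 0, taylor_coef j != 0 &
    [forall k : 'I_(size f), (taylor_coef k != 0) ==>
      if (i <= k <= j)%N then chord i j k <= (ordinate k)%:R
      else chord i j k < (ordinate k)%:R]].

Definition is_neg_side (i j : nat) : bool :=
  is_side i j && (ordinate j < ordinate i)%N.

Definition on_neg_polygon (k : nat) : bool :=
  (taylor_coef k != 0) &&
  [exists i : 'I_(size f), exists j : 'I_(size f),
    [&& is_neg_side i j, (i <= k <= j)%N & (ordinate k)%:R == chord i j k]].

Definition residue (k : nat) : 'F_3 :=
  if on_neg_polygon k then ((taylor_coef k %/ 3 ^+ ordinate k)%Z)%:~R else 0.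

(* For a side of slope -h/e in lowest terms and horizontal length d * e,
   d is the gcd of its height d * h and its length. *)
Definition side_degree (i j : nat) : nat :=
  gcdn (ordinate i - ordinate j) (j - i).
Definition side_ramification (i j : nat) : nat :=
  ((j - i) %/ side_degree i j)%N.

Definition residual_poly (i j : nat) : {poly 'F_3} :=
  \poly_(k < (side_degree i j).+1) residue (i + k * side_ramification i j).

Definition regular : bool :=
  [forall i : 'I_(size f), forall j : 'I_(size f),
    is_neg_side i j ==> separable_poly (residual_poly i j)].

Definition irregular : bool := ~~ regular.
End Polygon.

(* One step of the iteration: mu is minus the slope of an inseparable side, and
   y any lift of a multiple root of its residual polynomial. *)
Definition iteration_step (f : {poly int}) (s t : int) : Prop :=
  exists (i j mu : nat) (y : int),
    [/\ is_neg_side f s i j,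
        ~~ separable_poly (residual_poly f s i j),
        (ordinate f s i - ordinate f s j = mu * (j - i))%N,
        ('X - (y%:~R)%:P) ^+ 2 %| residual_poly f s i j
      & t = s + y * 3 ^+ mu].

Inductive iteration (f : {poly int}) : int -> int -> Prop :=
| iteration_stop s : regular f s -> iteration f s s
| iteration_next s t r :
    irregular f s -> iteration_step f s t -> iteration f t r -> iteration f s r.

(* Whatever choices are made, the iteration started at s never gets stuck and
   reaches a regular integer after finitely many steps. *)
Inductive iteration_terminates (f : {poly int}) : int -> Prop :=
| terminates_stop s : regular f s -> iteration_terminates f s
| terminates_next s :
    irregular f s -> (exists t, iteration_step f s t) ->
    (forall t, iteration_step f s t -> iteration_terminates f t) ->
    iteration_terminates f s.

Inductive selected (f : {poly int}) (s0 s1 : int) : int -> Prop :=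
| selected_s0 : regular f s0 -> selected f s0 s1 s0
| selected_s1 : irregular f s0 -> regular f s1 -> selected f s0 s1 s1
| selected_iter s :
    irregular f s0 -> irregular f s1 -> iteration f s1 s -> selected f s0 s1 s.

(* The last two indices are nu1 and nu2; u1 may be infinite. In the last case
   nu1 is given by an equation to avoid a truncated subtraction. *)
Inductive exponents (f : {poly int}) (Delta u0 : nat) (u1 : \bar rat) (s1 : int)
    : nat -> nat -> Prop :=
| exponents_a n : u1 = n%:R%:E -> ((2 * u0)%:R%:E >= 3%:R%:E * u1)%E ->
    exponents f Delta u0 u1 s1 n (n %/ 2)
| exponents_b : ((2 * u0)%:R%:E < 3%:R%:E * u1)%E -> ~~ (3 %| u0)%N ->
    exponents f Delta u0 u1 s1 (2 * u0 %/ 3) (u0 %/ 3)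
| exponents_c : ((2 * u0)%:R%:E < 3%:R%:E * u1)%E -> (3 %| u0)%N ->
    v3 f.[s1] = (u0 + 1)%:R%:E ->
    exponents f Delta u0 u1 s1 (2 * u0 %/ 3) (u0 %/ 3)
| exponents_d : ((2 * u0)%:R%:E < 3%:R%:E * u1)%E -> (3 %| u0)%N ->
    (v3 f.[s1] > (u0 + 1)%:R%:E)%E ->
    v3 f^`().[s1] = (2 * u0 %/ 3 + 1)%:R%:E ->
    exponents f Delta u0 u1 s1 (2 * u0 %/ 3 + 1) (u0 %/ 3)
| exponents_e : ((2 * u0)%:R%:E < 3%:R%:E * u1)%E -> (3 %| u0)%N ->
    v3 f.[s1] = (u0 + 2)%:R%:E ->
    (v3 f^`().[s1] > (2 * u0 %/ 3 + 1)%:R%:E)%E ->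
    exponents f Delta u0 u1 s1 (2 * u0 %/ 3 + 1) (u0 %/ 3)
| exponents_f n : ((2 * u0)%:R%:E < 3%:R%:E * u1)%E -> (3 %| u0)%N ->
    (v3 f.[s1] > (u0 + 2)%:R%:E)%E ->
    (v3 f^`().[s1] > (2 * u0 %/ 3 + 1)%:R%:E)%E ->
    (n + u0 %/ 3 + 1 = Delta %/ 2)%N ->
    exponents f Delta u0 u1 s1 n (u0 %/ 3 + 1).

(* Main.v *)
Require Import Defs.
From mathcomp Require Import ring lra zify.
Import Order.TTheory GRing.Theory Num.Theory.
Local Open Scope ring_scope.
Set Implicit Arguments.
Unset Strict Implicit.
Unset Printing Implicit Defensive.

(** Write A_0, ..., A_4 for the Taylor coefficients of f at an integer s prime
to 3, so that A_3 = 4s and A_4 = 1 are units at 3, and put phi = theta - s.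
Modulo 3 the quartic is x (x + b)^3, hence over Z_3 it has one root divisible
by 3 and three roots near -b; only the cubic part, seen at s near -b, matters.

The elements of the basis are the quotients q_3 = -A_0/phi =
phi^3 + A_3 phi^2 + A_2 phi + A_1 and q_2 = (q_3 - A_1)/phi =
phi^2 + A_3 phi + A_2, divided by powers of 3.  They satisfy
q_3^4 - A_1 q_3^3 + A_2 A_0 q_3^2 - A_3 A_0^2 q_3 + A_0^3 = 0 and
q_2^2 = A_2 q_2 + A_3 q_3 - A_0 - A_1 (phi + A_3), from which one reads off the
powers of 3 by which they may be divided (int3_omega3, int3_omega2).

That nothing larger is integral is shown on the conjugates, in the field of
algebraic numbers: if (m_0 + m_1 theta + m_2 omega_2 + m_3 omega_3)/3 is
integral at 3, then 3 divides every m_j (saturated3).  There are two reasons.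
If the discriminant of f has valuation at most 2 (nu_1 + nu_2) + 1, Cramer's
rule gives it (saturated_disc); this covers the cases (a), (d) and (f).  If
the polygon has a single side from (0, m) to (3, 0) with m prime to 3, the
discriminant is too large, but the cubic part is totally ramified: omega_2,
omega_3 lie in the radical of 3, their product divided by 3 is a unit multiple
of theta modulo the radical, and a multiple n theta lies in the radical only
if 3 divides n, because the third elementary symmetric function of the
conjugates of theta is the unit -b (saturated_ramified); this covers the cases
(b), (c) and (e).

The condition v_3(A_2(s_0)) > Delta/6 keeps the point of abscissa 2 off the
polygon at s_0: the discriminant is isobaric in the A_i up to terms of higher
weight (taylor_disc_weight), so 3^(2j) | A_1 and 3^(3j) | A_0 imply
3^(j+1) | A_2 (A2_large_weight).  The first part follows, since over F_3 the
polynomial c_3 y^3 + c_1 y + c_0 is separable exactly when c_1 is nonzero.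
In the case (f) the first correction puts the point of abscissa 2 exactly at
height k + 1, where u_0 = 3k, and it stays there.  The expansion is then steep
of some level n (definition steep), its discriminant is divisible by 3^(4(k+1) + n),
each step of the iteration increases n (steep_step), and at a regular integer
n can be increased until 4(k+1) + n = Delta (steep_regular).  The first fact
gives termination, the second the exponent nu_1 in the case (f). *)

(** * The discriminant of a depressed quartic *)

(** The function [bump], in a form that reduces on literals without unfolding
the boolean order. *)
Definition skip (j k : nat) : nat := if Nat.leb j k then k.+1 else k.
(** Laplace expansion along the first row, skipping the entries None, which
stand for zeros: a literal sparse determinant then unfolds to few terms. *)
Fixpoint sparse_det (R : comNzRingType) (n : nat) (F : nat -> nat -> option R) : R :=
  if n is n'.+1 then
    foldr (fun j acc => if F 0%N j is Some x
       then (if odd j then - x else x)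
            * sparse_det n' (fun i k => F i.+1 (skip j k)) + acc else acc)
      0 (iota 0 n)
  else 1.

Lemma sparse_detE (R : comNzRingType) (n : nat) (F : nat -> nat -> option R) :
  \det (\matrix_(i < n, j < n) odflt 0 (F i j)) = sparse_det n F.
Proof.
elim: n F => [|n IHn] F; first by rewrite det_mx00.
have foldE s : foldr (fun j acc => if F 0%N j is Some x
       then (if odd j then - x else x)
            * sparse_det n (fun i k => F i.+1 (skip j k)) + acc else acc) 0 s =
    \sum_(j <- s) odflt 0 (F 0%N j)
        * ((-1) ^+ j * sparse_det n (fun i k => F i.+1 (skip j k))).
  elim: s => [|j s IHs] /=; first by rewrite big_nil.
  rewrite big_cons -IHs; case: (F 0%N j) => [x|] /=; last by rewrite mul0r add0r.
  rewrite -signr_odd; case: (odd j);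
    by rewrite ?expr1 ?expr0 ?mulN1r ?mulrN ?mulNr ?mul1r.
rewrite (expand_det_row _ ord0) [RHS](foldE (iota 0 n.+1)).
have -> : iota 0 n.+1 = index_iota 0 n.+1 by rewrite /index_iota subn0.
rewrite big_mkord; apply: eq_bigr => j _; rewrite mxE; congr (_ * _).
rewrite /cofactor add0n -IHn; congr (_ * \det _).
apply/matrixP => i k; rewrite !mxE /= /bump /skip.
have -> : Nat.leb j k = (j <= k)%N.
  by elim: (j : nat) (k : nat) => [|j' IH] [|k'] //=; exact: IH.
by case: (j <= k)%N.
Qed.

Lemma resultantE (R : comNzRingType) (p q : {poly R}) :
  let F i j := if (i < (size q).-1)%N then p`_(j - i) *+ (i <= j)
     else q`_(j - (i - (size q).-1)) *+ (i - (size q).-1 <= j) in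
  let n := ((size q).-1 + (size p).-1)%N in
  resultant p q = \det (\matrix_(i < n, j < n) F i j).
Proof.
move=> F n; congr (\det _); apply/matrixP => i j.
rewrite Sylvester_mxE mxE /F; by case: splitP => k -> //; rewrite addKn.
Qed.

Definition quartic_disc (R : comNzRingType) (a b c : R) : R :=
  16%:R * a ^+ 4 * c - 4%:R * a ^+ 3 * b ^+ 2 - 128%:R * a ^+ 2 * c ^+ 2
  + 144%:R * a * b ^+ 2 * c - 27%:R * b ^+ 4 + 256%:R * c ^+ 3.

Definition quartic (a b c : int) : {poly int} :=
  'X^4 + a%:P * 'X^2 + b%:P * 'X + c%:P.

Lemma quarticE a b c : quartic a b c = Poly [:: c; b; a; 0; 1].
Proof.
rewrite /quartic /= !cons_poly_def; ring.
Qed.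

Lemma polyseq_quartic a b c : quartic a b c = [:: c; b; a; 0; 1] :> seq int.
Proof. by rewrite quarticE (@PolyK _ 0). Qed.

Lemma deriv_quartic a b c : (quartic a b c)^`() = Poly [:: b; 2%:R * a; 0; 4].
Proof.
rewrite /quartic !derivE /= !cons_poly_def; ring.
Qed.

Lemma disc_quartic a b c : disc (quartic a b c) = quartic_disc a b c.
Proof.
rewrite /disc lead_coefE polyseq_quartic /= divz1.
have -> : (-1 : int) ^+ 'C(4, 2) = 1 by [].
rewrite mul1r resultantE deriv_quartic (@PolyK _ 0) // polyseq_quartic.
(* The Sylvester matrix of f and f', three rows of f above four rows of f'. *)
pose G i j : option int := nth None (nth [::] [::
 [:: Some c; Some b; Some a; None; Some 1; None; None];
 [:: None; Some c; Some b; Some a; None; Some 1; None];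
 [:: None; None; Some c; Some b; Some a; None; Some 1];
 [:: Some b; Some (2%:R * a); None; Some 4%:R; None; None; None];
 [:: None; Some b; Some (2%:R * a); None; Some 4%:R; None; None];
 [:: None; None; Some b; Some (2%:R * a); None; Some 4%:R; None];
 [:: None; None; None; Some b; Some (2%:R * a); None; Some 4%:R]] i) j.
transitivity (sparse_det 7 G).
  rewrite -sparse_detE.
  apply: (congr1 (fun M : 'M[int]_7 => \det M)).
  apply/matrixP => i j; rewrite !mxE.
  by case: i j => [[|[|[|[|[|[|[|i]]]]]]] hi] [[|[|[|[|[|[|[|j]]]]]]] hj].
rewrite /quartic_disc.
lazy beta iota zeta delta [sparse_det skip foldr iota G nth odd negb Nat.leb].
ring.
Qed.

(** The discriminant of x^4 + A3 x^3 + A2 x^2 + A1 x + A0, which a translation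
does not change.  With A3 a unit, the last five terms are the main ones: they
make up A3^2 times the discriminant of A3 x^3 + A2 x^2 + A1 x + A0. *)
Definition taylor_disc (A0 A1 A2 A3 : int) : int :=
  256 * A0 ^+ 3 - 192 * A3 * A1 * A0 ^+ 2 - 128 * A2 ^+ 2 * A0 ^+ 2
  + 144 * A2 * A1 ^+ 2 * A0 - 27 * A1 ^+ 4 + 144 * A3 ^+ 2 * A2 * A0 ^+ 2
  - 6 * A3 ^+ 2 * A1 ^+ 2 * A0 - 80 * A3 * A2 ^+ 2 * A1 * A0
  + 18 * A3 * A2 * A1 ^+ 3 + 16 * A2 ^+ 4 * A0 - 4 * A2 ^+ 3 * A1 ^+ 2
  - 27 * A3 ^+ 4 * A0 ^+ 2 + 18 * A3 ^+ 3 * A2 * A1 * A0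
  - 4 * A3 ^+ 3 * A1 ^+ 3 - 4 * A3 ^+ 2 * A2 ^+ 3 * A0
  + A3 ^+ 2 * A2 ^+ 2 * A1 ^+ 2.

Lemma quartic_disc_taylor (a b c s : int) :
  quartic_disc a b c =
  taylor_disc (s ^+ 4 + a * s ^+ 2 + b * s + c) (4 * s ^+ 3 + 2 * a * s + b)
    (6 * s ^+ 2 + a) (4 * s).
Proof. rewrite /quartic_disc /taylor_disc; ring. Qed.

(** * Lower bounds on 3-adic valuations *)

(** The bound v_3(x) >= n, in a form that covers x = 0 without infinite values. *)
Definition v3ge (n : nat) (x : int) : bool := (3 ^+ n %| x)%Z.

Lemma v3ge_0 (x : int) : v3ge 0 x. Proof. by rewrite /v3ge dvd1z. Qed.

Lemma v3ge_le m n (x : int) : v3ge m x -> (n <= m)%N -> v3ge n x.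
Proof. by rewrite /v3ge => h le; apply: dvdz_trans h; apply: dvdz_exp2l. Qed.

Lemma v3geM m n (x y : int) : v3ge m x -> v3ge n y -> v3ge (m + n) (x * y).
Proof. by rewrite /v3ge exprD; apply: dvdz_mul. Qed.

Lemma v3geX m n (x : int) : v3ge m x -> v3ge (m * n) (x ^+ n).
Proof. by rewrite /v3ge exprM; apply: dvdz_exp2r. Qed.

Lemma v3geD n (x y : int) : v3ge n x -> v3ge n y -> v3ge n (x + y).
Proof. exact: rpredD. Qed.

Lemma v3geN n (x : int) : v3ge n x -> v3ge n (- x).
Proof. by rewrite /v3ge rpredN. Qed.

Lemma v3ge_27 : v3ge 3 27. Proof. by []. Qed.
Lemma v3ge_144 : v3ge 2 144. Proof. by []. Qed.
Lemma v3ge_18 : v3ge 2 18. Proof. by []. Qed.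
Lemma v3ge_6 : v3ge 1 6. Proof. by []. Qed.
Lemma v3ge_3 : v3ge 1 3. Proof. by []. Qed.

(** [lia] slows down on hypotheses about divisibility and powers in the
integers; here they are dropped and only comparisons of exponents remain. *)
Ltac nlia := repeat match goal with
  | H : ?T |- _ => match T with
      | context [@GRing.exp] => clear H
      | context [dvdz] => clear H
      | context [v3ge] => clear H
      | context [intmul] => clear H
      | context [modz] => clear H
      | context [v3] => clear H
      end
  end; lia.

(** Adds up the known valuations of the factors of a monomial. *)
Ltac v3ge_mono := lazymatch goal with
  | |- is_true (v3ge _ (_ * _)) => eapply v3geM; [v3ge_mono | v3ge_mono]
  | |- is_true (v3ge _ (_ ^+ _)) => eapply v3geX; v3ge_mono
  | |- is_true (v3ge _ 3) => apply v3ge_3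
  | |- is_true (v3ge _ 6) => apply v3ge_6
  | |- is_true (v3ge _ 18) => apply v3ge_18
  | |- is_true (v3ge _ 27) => apply v3ge_27
  | |- is_true (v3ge _ 144) => apply v3ge_144
  | |- is_true (v3ge _ ?x) =>
      first [ match goal with h : is_true (v3ge _ x) |- _ => exact h end
            | apply v3ge_0 ]
  end.

Ltac v3ge_auto := lazymatch goal with
  | |- is_true (v3ge _ (_ + _)) => apply v3geD; [v3ge_auto | v3ge_auto]
  | |- is_true (v3ge _ (- _)) => apply v3geN; v3ge_auto
  | |- _ => eapply v3ge_le; [v3ge_mono | nlia]
  end.

(** Giving A_i the weight 3 - i, the main terms of the discriminant have weight
6 and all the others have a larger weight. *)
Lemma taylor_disc_weight (A0 A1 A2 A3 : int) j :
  v3ge (3 * j) A0 -> v3ge (2 * j) A1 -> v3ge j A2 -> v3ge (6 * j) (taylor_disc A0 A1 A2 A3).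
Proof. by move=> h0 h1 h2; rewrite /taylor_disc; v3ge_auto. Qed.

(** The bound for points on or above the line of slope -n/2 through (2, j). *)
Lemma taylor_disc_state (A0 A1 A2 A3 : int) j n m : (2 * j <= n)%N -> (n <= 2 * m)%N ->
  v3ge (j + n) A0 -> v3ge (j + m) A1 -> v3ge j A2 -> v3ge (4 * j + n) (taylor_disc A0 A1 A2 A3).
Proof. by move=> hn hm h0 h1 h2; rewrite /taylor_disc; v3ge_auto. Qed.

Lemma v3ge_logn (x : int) n : x != 0 -> v3ge n x = (n <= logn 3 `|x|)%N.
Proof. by move=> nz; rewrite /v3ge dvdzE abszX pfactor_dvdn ?absz_gt0. Qed.

Lemma v3ge_split m n (x : int) : v3ge (m + n) (3 ^+ m * x) = v3ge n x.
Proof. by rewrite /v3ge exprD dvdz_mul2l // expf_neq0. Qed.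

Lemma Euclid3 (x y : int) : (3 %| x * y)%Z = (3 %| x)%Z || (3 %| y)%Z.
Proof. by rewrite !dvdzE abszM Euclid_dvdM. Qed.

Lemma Euclid3X (x : int) n : (3 %| x ^+ n)%Z = (0 < n)%N && (3 %| x)%Z.
Proof. by rewrite !dvdzE abszX Euclid_dvdX // andbC lt0n. Qed.

Lemma v3ge_exact (x : int) : x != 0 ->
  exists2 u : int, x = 3 ^+ logn 3 `|x| * u & ~~ (3 %| u)%Z.
Proof.
move=> nz; have /dvdzP[u xE] : v3ge (logn 3 `|x|) x by rewrite v3ge_logn.
exists u; first by rewrite mulrC.
apply/negP => h3; suff : v3ge (logn 3 `|x| + 1) x by rewrite v3ge_logn // addn1 ltnn.
by rewrite {2}xE mulrC v3ge_split.
Qed.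

Lemma logn3_eq (x u : int) n : x = 3 ^+ n * u -> ~~ (3 %| u)%Z -> logn 3 `|x| = n.
Proof.
move=> -> h; have nz : u != 0 by apply: contraNneq h => ->.
rewrite abszM abszX lognM ?expn_gt0 ?absz_gt0 // pfactorK //.
by rewrite logn_coprime ?addn0 // prime_coprime.
Qed.

Lemma v3ge_gauss (x y : int) n : ~~ (3 %| x)%Z -> v3ge n (x * y) = v3ge n y.
Proof.
move=> h; rewrite /v3ge !dvdzE abszM abszX Gauss_dvdr // coprimeXl //.
by rewrite prime_coprime.
Qed.

(** * Separability of small polynomials over F_3 *)
Section F3.
Implicit Types (n : int) (p : {poly 'F_3}).

Lemma intr_F3_eq0 n : ((n%:~R : 'F_3) == 0) = (3 %| n)%Z.
Proof. by rewrite (dvdz_pcharf (pchar_Fp _)). Qed.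

Lemma F3_lift (x : 'F_3) : exists n : int, n%:~R = x.
Proof. by exists (Posz (nat_of_ord x)); rewrite -pmulrn natr_Zp. Qed.

Lemma F3_3 : (3 : 'F_3) = 0. Proof. exact/eqP. Qed.

Lemma F3_2 : (2 : 'F_3) = -1. Proof. exact/eqP. Qed.

(** In characteristic 3 the cubic term disappears from the derivative, which
therefore has at most the root p_1/p_2. *)
Lemma deriv_F3 p : (size p <= 4)%N -> p^`() = (2 * p`_2) *: 'X + (p`_1)%:P.
Proof.
move=> hp; apply/polyP => i; rewrite coef_deriv coefD coefZ coefX coefC.
case: i => [|[|[|i]]] /=; first by rewrite mulr0 add0r.
- by rewrite mulr1 addr0 mulr_natl.
- by rewrite mulr0 addr0 -mulr_natl F3_3 mul0r.
by rewrite nth_default ?mul0rn ?mulr0 ?addr0 // (leq_trans hp).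
Qed.

Lemma separable_F3_deg2 p : (size p <= 4)%N -> p`_2 != 0 ->
  separable_poly p = ~~ root p (p`_1 / p`_2).
Proof.
move=> hp h2; rewrite separable_poly.unlock deriv_F3 //.
have p2N0 : 2 * p`_2 != 0 by rewrite mulf_neq0.
have -> : (2 * p`_2) *: 'X + (p`_1)%:P = (2 * p`_2) *: ('X - (p`_1 / p`_2)%:P).
  rewrite scalerBr -[X in _ = _ - X]mul_polyC -polyCM; congr (_ + _).
  by rewrite F3_2 mulN1r mulrCA mulNr divff // mulrN1 polyCN opprK.
by rewrite coprimepZr // coprimep_XsubC.
Qed.

Lemma separable_F3_deg1 p : (size p <= 4)%N -> p`_2 = 0 -> p`_1 != 0 ->
  separable_poly p.
Proof.
move=> hp h2 h1; rewrite separable_poly.unlock deriv_F3 // h2 mulr0 scale0r add0r.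
by rewrite -[_%:P]mulr1 mul_polyC coprimepZr // coprimep1.
Qed.

Lemma cube_F3 (x : 'F_3) : x ^+ 3 = x.
Proof. by case: x => [[|[|[|x]]] h] //; apply/val_inj. Qed.

Lemma inseparable_F3_deg0 p : (1 < size p <= 4)%N -> p`_2 = 0 -> p`_1 = 0 ->
  ~~ separable_poly p.
Proof.
move=> /andP[h1 h4] h2 h1'; rewrite separable_poly.unlock deriv_F3 // h2 h1' mulr0 scale0r.
by rewrite add0r coprimep0 -size_poly_eq1 neq_ltn h1 orbT.
Qed.

(** A repeated factor of a polynomial of degree at most 3 over F_3 is linear:
it comes from the only root of the derivative, or, when the derivative
vanishes, from p = c_3 x^3 + c_0 being a cube. *)
Lemma inseparable_F3_root p : (size p <= 4)%N -> p != 0 -> ~~ separable_poly p ->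
  exists y : int, ('X - (y%:~R)%:P) ^+ 2 %| p.
Proof.
move=> hp pN0; have [h2|h2] := eqVneq p`_2 0; last first.
  rewrite separable_F3_deg2 // negbK => /factor_theorem[q Ep].
  have [y Ey] := F3_lift (p`_1 / p`_2); exists y; rewrite Ey.
  move: Ep; set z := _ / _ => Ep.
  have : root p^`() z.
    rewrite deriv_F3 // rootE; apply/eqP.
    transitivity (3 * p`_1); last by rewrite F3_3 mul0r.
    by rewrite hornerD hornerZ hornerX hornerC /z; field.
  rewrite {1}Ep derivM derivXsubC mulr1 rootE !hornerE subrr mulr0 add0r.
  by move=> /factor_theorem[q' Eq]; rewrite Ep Eq -mulrA dvdp_mull // expr2.
have [h1|h1] := eqVneq p`_1 0; last by rewrite separable_F3_deg1.
have Ep : p = (p`_0)%:P + p`_3 *: 'X^3.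
  apply/polyP => i; rewrite coefD coefZ coefXn coefC.
  case: i => [|[|[|[|i]]]] /=; rewrite ?mulr0 ?mulr1 ?addr0 ?add0r //.
  by rewrite nth_default // (leq_trans hp).
have [h3|h3] := eqVneq p`_3 0.
  rewrite h3 scale0r addr0 in Ep.
  have c0 : p`_0 != 0 by apply: contraNneq pN0 => c0; rewrite Ep c0.
  by rewrite Ep separable_poly.unlock derivC coprimep0 -size_poly_eq1 size_polyC c0.
move=> _; have [y Ey] := F3_lift (- p`_0 / p`_3); exists y; rewrite Ey.
have Ep3 : p = p`_3 *: ('X - (- p`_0 / p`_3)%:P) ^+ 3.
  rewrite {1}Ep; set z := _ / _.
  have -> : ('X - z%:P) ^+ 3 = 'X^3 - (z ^+ 3)%:P :> {poly 'F_3}.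
    rewrite polyC_exp; transitivity ('X^3 - z%:P ^+ 3 + 3%:P * ('X * z%:P * (z%:P - 'X))).
      by rewrite polyC_natr; ring.
    by rewrite F3_3 mul0r addr0.
  rewrite cube_F3 scalerBr addrC; congr (_ + _).
  by rewrite -mul_polyC -polyCM /z mulrCA divff // mulr1 polyCN opprK.
by rewrite [X in _ %| X]Ep3 dvdpZr // dvdp_exp2l.
Qed.

Lemma double_root_F3 p z : ('X - z%:P) ^+ 2 %| p -> root p z /\ root p^`() z.
Proof.
move=> /dvdpP[q ->]; rewrite expr2 !derivM derivXsubC !rootE !(hornerXsubC, hornerM, hornerD) subrr.
by rewrite !(mulr0, mul0r, addr0) eqxx.
Qed.

End F3.

(** * Newton polygons through integer inequalities *)

Section Polygon.
Variables (f : {poly int}) (s : int).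
Notation A := (taylor_coef f s).
Notation o := (ordinate f s).

(** The ordinate of the chord at abscissa k multiplied by j - i, an integer. *)
Definition chord_num (i j k : nat) : int :=
  (o i)%:Z * (j%:Z - k%:Z) + (o j)%:Z * (k%:Z - i%:Z).

Lemma chord_cmp i j k (r : nat) : (i < j)%N ->
  [/\ (chord f s i j k <= r%:R) = (chord_num i j k <= r%:Z * (j%:Z - i%:Z)),
      (chord f s i j k < r%:R) = (chord_num i j k < r%:Z * (j%:Z - i%:Z))
    & (r%:R == chord f s i j k) = (r%:Z * (j%:Z - i%:Z) == chord_num i j k)].
Proof.
move=> lij; rewrite /chord_num; set D := _ + _; set E := _ * _.
have ji : 0 < (j%:R - i%:R : rat) by rewrite subr_gt0 ltr_nat.
have eD : (D%:~R : rat) = chord f s i j k * (j%:R - i%:R).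
  rewrite /chord /D !(rmorphD, rmorphB, rmorphM) /= -!pmulrn.
  by field; rewrite gt_eqF.
have eE : (E%:~R : rat) = r%:R * (j%:R - i%:R).
  by rewrite /E rmorphM rmorphB /= -!pmulrn.
split; first by rewrite -(ler_int rat) eD eE ler_pM2r.
  by rewrite -(ltr_int rat) eD eE ltr_pM2r.
by rewrite -(eqr_int rat) eD eE (inj_eq (mulIf _)) // gt_eqF.
Qed.

Lemma is_sideP i j : is_side f s i j ->
  [/\ (i < j)%N, A i != 0, A j != 0 & forall k, (k < size f)%N -> A k != 0 ->
    if (i <= k <= j)%N then chord_num i j k <= (o k)%:Z * (j%:Z - i%:Z)
    else chord_num i j k < (o k)%:Z * (j%:Z - i%:Z)].
Proof.
case/and4P=> lij Ai Aj /forallP H; split=> // k lk Ak.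
have /implyP/(_ Ak) := H (Ordinal lk).
by case: (chord_cmp k (o k) lij) => -> -> _.
Qed.

Lemma is_sideI i j : (i < j)%N -> A i != 0 -> A j != 0 ->
  (forall k, (k < size f)%N -> A k != 0 ->
    if (i <= k <= j)%N then chord_num i j k <= (o k)%:Z * (j%:Z - i%:Z)
    else chord_num i j k < (o k)%:Z * (j%:Z - i%:Z)) -> is_side f s i j.
Proof.
move=> lij Ai Aj H; apply/and4P; split=> //; apply/forallP=> k.
apply/implyP=> Ak; have := H k (ltn_ord k) Ak.
by case: (chord_cmp k (o k) lij) => -> -> _.
Qed.

(** The residues refer to the whole polygon.  Over the abscissae of one side,
however, only that side counts: another side through (k, o k) runs below the
points of abscissae i and j, hence below the chord that joins them. *)
Lemma on_neg_polygon_side i j k : is_neg_side f s i j ->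
    (i < size f)%N -> (j < size f)%N -> (i <= k <= j)%N ->
  on_neg_polygon f s k = (A k != 0) &&
    ((o k)%:Z * (j%:Z - i%:Z) ==
     chord_num i j k).
Proof.
move=> hneg li lj hk; have [/is_sideP[lij Ai Aj Hs] _] := andP hneg.
rewrite /on_neg_polygon; case: (eqVneq (A k) 0) => //= Ak.
apply/existsP/idP => [[i' /existsP[j' /and3P[/andP[/is_sideP[lij' Ai' Aj' Hs'] _] hk']]]|].
  case: (chord_cmp k (o k) lij') => _ _ -> /eqP Ek.
  have lk : (k < size f)%N by case/andP: hk => _ /leq_ltn_trans; apply.
  have := Hs k lk Ak; rewrite hk /= => Hk.
  have Hi : (o i')%:Z * (j'%:Z - i%:Z) + (o j')%:Z * (i%:Z - i'%:Z) <= (o i)%:Z * (j'%:Z - i'%:Z).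
    by have := Hs' i li Ai => /=; case: ifP => _ // /ltW.
  have Hj : (o i')%:Z * (j'%:Z - j%:Z) + (o j')%:Z * (j%:Z - i'%:Z) <= (o j)%:Z * (j'%:Z - i'%:Z).
    by have := Hs' j lj Aj => /=; case: ifP => _ // /ltW.
  rewrite eq_le Hk andbT -(ler_pM2r (_ : 0 < j'%:Z - i'%:Z)) ?subr_gt0 //.
  move: Ek Hi Hj hk lij lij'; rewrite /chord_num; clear.
  move: (o i) (o j) (o k) (o i') (o j') => oi oj ok oi' oj' Ek Hi Hj /andP[ik kj] _ _.
  have := lerD (ler_wpM2r (_ : 0 <= j%:Z - k%:Z) Hi) (ler_wpM2r (_ : 0 <= k%:Z - i%:Z) Hj).
  rewrite !subr_ge0 !lez_nat ik kj => /(_ isT isT).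
  suff -> : (oi'%:Z * (j'%:Z - i%:Z) + oj'%:Z * (i%:Z - i'%:Z)) * (j%:Z - k%:Z) +
            (oi'%:Z * (j'%:Z - j%:Z) + oj'%:Z * (j%:Z - i'%:Z)) * (k%:Z - i%:Z) =
            ok%:Z * (j'%:Z - i'%:Z) * (j%:Z - i%:Z).
    by move=> h; lia.
  by rewrite Ek; ring.
move=> Ek; exists (Ordinal li); apply/existsP; exists (Ordinal lj) => /=.
by rewrite hneg hk /=; case: (chord_cmp k (o k) lij) => _ _ ->.
Qed.

(** On a side of integral slope -mu the residues are the coefficients, modulo
3, of f(s + 3^mu y) divided by its content 3^E. *)
Lemma residue_on_side i j mu E (B : int) k : is_neg_side f s i j ->
    (i < size f)%N -> (j < size f)%N -> (i <= k <= j)%N ->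
    (o i + mu * i = E)%N -> (o j + mu * j = E)%N ->
    A k * 3 ^+ (mu * k) = 3 ^+ E * B ->
  residue f s k = B%:~R.
Proof.
move=> hneg li lj hk Ei Ej EB; have [/is_sideP[lij Ai Aj Hs] _] := andP hneg.
rewrite /residue (on_neg_polygon_side hneg) //.
have p3 n : (3 : int) ^+ n != 0 by rewrite expf_neq0.
case: (eqVneq (A k) 0) => [Ak|Ak] /=.
  by move/eqP: EB; rewrite Ak mul0r eq_sym mulf_eq0 (negPf (p3 _)) /= => /eqP->.
have [u Eu hu] := v3ge_exact Ak; rewrite -/(o k) in Eu.
have lk : (k < size f)%N by case/andP: hk => _ /leq_ltn_trans; apply.
have := Hs k lk Ak; rewrite hk /=.
have -> : chord_num i j k =
   (E%:Z - (mu * k)%:Z) * (j%:Z - i%:Z).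
  rewrite /chord_num; have -> : (o i)%:Z = E%:Z - mu%:Z * i%:Z by lia.
  have -> : (o j)%:Z = E%:Z - mu%:Z * j%:Z by lia.
  by rewrite PoszM; ring.
have ji : j%:Z - i%:Z != 0 by lia.
rewrite ler_pM2r ?subr_gt0 // (inj_eq (mulIf ji)) => leE.
have lE : (E <= o k + mu * k)%N by lia.
have EB' : B = 3 ^+ (o k + mu * k - E) * u.
  apply: (mulfI (p3 E)); rewrite -EB {1}Eu mulrA -exprD subnKC // exprD.
  by rewrite mulrAC.
case: eqP => [eqE|neE].
  have -> : B = u by rewrite EB' (_ : (_ - _)%N = 0%N) ?mul1r //; lia.
  by rewrite {1}Eu mulrC mulzK.
apply/esym/eqP; rewrite intr_F3_eq0 EB' Euclid3 Euclid3X /= andbT.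
by apply/orP; left; lia.
Qed.

Lemma residual_poly_slope i j mu : (i < j)%N ->
    (o i = o j + mu * (j - i))%N ->
  residual_poly f s i j = \poly_(k < (j - i).+1) residue f s (i + k).
Proof.
move=> lij Eo.
have Ed : side_degree f s i j = (j - i)%N.
  by rewrite /side_degree Eo addKn gcdnC gcdnMl.
rewrite /residual_poly /side_ramification Ed divnn subn_gt0 lij /=.
by apply/polyP => k; rewrite !coef_poly muln1.
Qed.

(** The points lie on or above the line of the side, strictly above it outside
the side; stated by divisibility so as to include vanishing coefficients. *)
Lemma side_v3ge i j mu k : is_neg_side f s i j ->
    (o i = o j + mu * (j - i))%N -> (k < size f)%N ->
  v3ge (o i + mu * i + ~~ (i <= k <= j)%N) (A k * 3 ^+ (mu * k)).
Proof.
move=> /andP[/is_sideP[lij Ai Aj Hs] _] Eo lk.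
have [->|Ak] := eqVneq (A k) 0; first by rewrite mul0r /v3ge dvdz0.
rewrite v3ge_logn ?mulf_neq0 ?expf_neq0 // abszM abszX lognM ?expn_gt0 ?absz_gt0 //.
rewrite pfactorK // -/(o k).
have -> : (o i + mu * i + ~~ (i <= k <= j) <= o k + mu * k)%N =
  ((o i)%:Z + mu%:Z * i%:Z - mu%:Z * k%:Z + (~~ (i <= k <= j)%N)%:Z <= (o k)%:Z) by lia.
have ji : 0 < j%:Z - i%:Z by lia.
have Ec : chord_num i j k = ((o i)%:Z + mu%:Z * i%:Z - mu%:Z * k%:Z) * (j%:Z - i%:Z).
  rewrite /chord_num; have -> : (o i)%:Z = (o j)%:Z + mu%:Z * (j%:Z - i%:Z) by lia.
  ring.
have := Hs k lk Ak; rewrite Ec ler_pM2r // ltr_pM2r //.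
by case: (_ && _) => /= h; lia.
Qed.

Lemma neg_sideI i j mu E : (0 < mu)%N -> (i < j)%N -> A i != 0 -> A j != 0 ->
    (o i + mu * i = E)%N -> (o j + mu * j = E)%N ->
    (forall k, (k < size f)%N -> v3ge (E + ~~ (i <= k <= j)%N) (A k * 3 ^+ (mu * k))) ->
  is_neg_side f s i j.
Proof.
move=> mu0 lij Ai Aj Ei Ej H; apply/andP; split; last first.
  by rewrite -(ltn_add2r (mu * j)) Ej -Ei ltn_add2l ltn_mul2l mu0.
apply: is_sideI => // k lk Ak.
have ji : 0 < j%:Z - i%:Z by lia.
have Ec : chord_num i j k = (E%:Z - mu%:Z * k%:Z) * (j%:Z - i%:Z).
  rewrite /chord_num.
  have -> : (o i)%:Z = E%:Z - mu%:Z * i%:Z by lia.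
  have -> : (o j)%:Z = E%:Z - mu%:Z * j%:Z by lia.
  ring.
rewrite Ec ler_pM2r // ltr_pM2r //.
have := H k lk; rewrite v3ge_logn ?mulf_neq0 ?expf_neq0 //.
rewrite abszM abszX lognM ?expn_gt0 ?absz_gt0 // pfactorK // -/(o k).
by case: (_ && _) => /= h; lia.
Qed.

Lemma side_degree1_separable i j : is_neg_side f s i j ->
    (i < size f)%N -> (j < size f)%N -> side_degree f s i j = 1%N ->
  separable_poly (residual_poly f s i j).
Proof.
move=> hneg li lj Ed; have [/is_sideP[lij Ai Aj Hs] _] := andP hneg.
have sz : (size (residual_poly f s i j) <= 2)%N.
  by rewrite /residual_poly Ed size_poly.
apply: separable_F3_deg1; first exact: leq_trans sz _.
  by rewrite nth_default.
rewrite /residual_poly /side_ramification Ed coef_poly /= divn1 mul1n subnKC 1?ltnW //.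
rewrite /residue (on_neg_polygon_side hneg) // ?(ltnW lij) ?leqnn // Aj /=.
have -> : chord_num i j j = (o j)%:Z * (j%:Z - i%:Z) by rewrite /chord_num; ring.
rewrite eqxx; have [u Eu hu] := v3ge_exact Aj.
by rewrite {1}Eu mulrC mulzK ?expf_neq0 // intr_F3_eq0.
Qed.
End Polygon.

Section QuarticTaylor.
Variables (a b c : int).
Notation f := (quartic a b c).

Lemma size_quartic : size f = 5.
Proof. by rewrite polyseq_quartic. Qed.

Lemma taylor_coef_quartic s k : taylor_coef f s k =
  nth 0 [:: s ^+ 4 + a * s ^+ 2 + b * s + c; 4 * s ^+ 3 + 2 * a * s + b;
            6 * s ^+ 2 + a; 4 * s; 1] k.
Proof.
rewrite /taylor_coef; have [lk|lk] := ltnP k 5; last first.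
  by rewrite nderivn_poly0 ?size_quartic // nth_default ?horner0.
rewrite /quartic -[X in b%:P * X]expr1 !mul_polyC.
rewrite !(nderivnD, nderivnZ, nderivnXn, nderivnC) !(hornerD, hornerZ, hornerMn, hornerXn).
have bE : ('C(4, 2) = 6%N) * ('C(4, 3) = 4%N) * ('C(2, 3) = 0%N) * ('C(2, 4) = 0%N)
  * ('C(1, 2) = 0%N) * ('C(1, 3) = 0%N) * ('C(1, 4) = 0%N) by [].
case: k lk => [|[|[|[|[|k]]]]] //= _; rewrite ?bE ?bin0 ?bin1 ?binn hornerC //=.
all: rewrite !subSS ?subn0 ?sub0n ?subnn; ring.
Qed.
End QuarticTaylor.

(** * Sides of the polygon of a depressed quartic *)

Section QuarticSides.
Variables (a b c : int).
Notation f := (quartic a b c).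
Notation A := (taylor_coef f).
Notation o := (ordinate f).

(** The point (3, 0) lies on the polygon, since A_3 = 4s is a unit. *)
Lemma neg_side_bound s i j : ~~ (3 %| s)%Z -> is_neg_side f s i j -> (i < j <= 3)%N.
Proof.
move=> hs /andP[/is_sideP[lij Ai Aj Hs] loij]; rewrite lij /=.
have j5 : (j < 5)%N.
  by rewrite ltnNge; apply: contraNN Aj => h; rewrite taylor_coef_quartic nth_default.
have A3s : A s 3 = 4 * s by rewrite taylor_coef_quartic.
have A3N : A s 3 != 0 by rewrite A3s; apply: contraNneq hs; lia.
have o3 : o s 3 = 0%N.
  by rewrite /ordinate A3s; apply: (@logn3_eq _ (4 * s)); rewrite ?mul1r // Euclid3.
case: (leqP j 3) => // j4; have Ej : j = 4%N by lia.
subst j; have := Hs 3 _ A3N; rewrite size_quartic /chord_num o3 => /(_ isT).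
have [Ei|Ei] : i = 3%N \/ (i <= 2)%N by lia.
  by move: loij; rewrite Ei o3.
by rewrite ifT; [nia | lia].
Qed.

Lemma regular_side s i j : regular f s -> (i < 5)%N -> (j < 5)%N ->
  is_neg_side f s i j -> separable_poly (residual_poly f s i j).
Proof.
rewrite /regular size_quartic => /forallP hr i5 j5.
by have /forallP/(_ (Ordinal j5))/implyP := hr (Ordinal i5).
Qed.

Lemma irregular_side s : irregular f s -> exists i j,
  [/\ (i < 5)%N, (j < 5)%N, is_neg_side f s i j & ~~ separable_poly (residual_poly f s i j)].
Proof.
rewrite /irregular /regular size_quartic => /forallPn[i /forallPn[j]].
by rewrite negb_imply => /andP[h1 h2]; exists i, j.
Qed.

(** An inseparable residual polynomial has degree at least 2; on a side of
length at most 3 this forces the ramification to be 1. *)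
Lemma inseparable_slope s i j : ~~ (3 %| s)%Z -> is_neg_side f s i j ->
    ~~ separable_poly (residual_poly f s i j) ->
  exists mu, [/\ (0 < mu)%N, (o s i = o s j + mu * (j - i))%N
    & (i, j) \in [:: (0, 3); (1, 3); (0, 2)]%N].
Proof.
move=> hs hneg hsep; have /andP[lij j3] := neg_side_bound hs hneg.
have [_ loij] := andP hneg.
have i5 : (i < size f)%N by rewrite size_quartic; lia.
have j5 : (j < size f)%N by rewrite size_quartic; lia.
have d1 : side_degree f s i j != 1%N.
  by apply: contraNneq hsep => /(side_degree1_separable hneg i5 j5).
have dl : (side_degree f s i j %| j - i)%N by rewrite /side_degree dvdn_gcdr.
have dh : (side_degree f s i j %| o s i - o s j)%N by rewrite /side_degree dvdn_gcdl.
have Ed : side_degree f s i j = (j - i)%N.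
  have := dvdn_leq _ dl; rewrite subn_gt0 => /(_ lij).
  move: d1 dl; move: (side_degree f s i j) => d d1 dl le.
  have d0 : d != 0%N by apply: contraTneq dl => ->; rewrite dvd0n; lia.
  have h : (j - i = 1 \/ j - i = 2 \/ j - i = 3)%N by lia.
  by case: h dl le => [|[]] ->; case: d d1 d0 => [|[|[|[|d]]]].
move: dh; rewrite Ed => /dvdnP[mu Emu]; exists mu.
have h2 : (1 < j - i)%N by move: d1; rewrite Ed; lia.
split; [by case: mu Emu => //; lia | lia |].
by rewrite !inE !xpair_eqE; lia.
Qed.

Lemma residual_coef s i j mu k (B : int) : ~~ (3 %| s)%Z -> is_neg_side f s i j ->
    (o s i = o s j + mu * (j - i))%N -> (i <= k <= j)%N ->
    A s k * 3 ^+ (mu * k) = 3 ^+ (o s i + mu * i) * B ->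
  (residual_poly f s i j)`_(k - i) = B%:~R.
Proof.
move=> hs hneg Eo hk EB; have /andP[lij j3] := neg_side_bound hs hneg.
have i5 : (i < size f)%N by rewrite size_quartic; lia.
have j5 : (j < size f)%N by rewrite size_quartic; lia.
rewrite (residual_poly_slope lij Eo) coef_poly ifT; last lia.
rewrite subnKC; last lia.
apply: (residue_on_side hneg i5 j5 hk _ _ EB) => //.
by rewrite Eo; nia.
Qed.

Lemma size_residual s i j mu : ~~ (3 %| s)%Z -> is_neg_side f s i j ->
    (o s i = o s j + mu * (j - i))%N ->
  (size (residual_poly f s i j) <= 4)%N.
Proof.
move=> hs hneg Eo; have /andP[lij j3] := neg_side_bound hs hneg.
rewrite (residual_poly_slope lij Eo); apply: leq_trans (size_poly _ _) _; lia.
Qed.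

(** The residual polynomial is, up to a power of the variable, the reduction
modulo 3 of f(s + 3^mu y)/3^E. *)
Lemma residual_reduction s i j mu : ~~ (3 %| s)%Z -> is_neg_side f s i j ->
    (o s i = o s j + mu * (j - i))%N ->
  exists g : {poly int}, [/\ (size g <= 5)%N,
    forall k, A s k * 3 ^+ (mu * k) = 3 ^+ (o s i + mu * i) * g`_k
    & map_poly intr g = 'X^i * residual_poly f s i j].
Proof.
move=> hs hneg Eo; have /andP[lij j3] := neg_side_bound hs hneg.
have ex k : exists B, A s k * 3 ^+ (mu * k) = 3 ^+ (o s i + mu * i) * B.
  have [k5|k5] := ltnP k 5; last first.
    by exists 0; rewrite mulr0 taylor_coef_quartic nth_default ?mul0r.
  have := side_v3ge hneg Eo (_ : (k < size f)%N); rewrite size_quartic => /(_ k5).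
  by move=> h; have /dvdzP[B ->] := v3ge_le h (leq_addr _ _); exists B; rewrite mulrC.
have [B EB] : exists B : nat -> int, forall k, (k < 5)%N ->
     A s k * 3 ^+ (mu * k) = 3 ^+ (o s i + mu * i) * B k.
  have [B0 E0] := ex 0%N; have [B1 E1] := ex 1%N; have [B2 E2] := ex 2%N.
  have [B3 E3] := ex 3%N; have [B4 E4] := ex 4%N.
  by exists (nth 0 [:: B0; B1; B2; B3; B4]); case=> [|[|[|[|[|]]]]].
exists (\poly_(k < 5) B k); split; first exact: size_poly.
  move=> k; rewrite coef_poly; case: ltnP => k5; first exact: EB.
  by rewrite mulr0 taylor_coef_quartic nth_default ?mul0r.
apply/polyP => k; rewrite coef_map coef_poly coefXnM /=.
have [ki|ik] := ltnP k i.
  have k5 : (k < 5)%N by lia.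
  rewrite k5; apply/eqP; rewrite intr_F3_eq0.
  have := side_v3ge hneg Eo (_ : (k < size f)%N); rewrite size_quartic => /(_ k5).
  by rewrite EB // leqNgt ki /= v3ge_split.
have [jk|kj] := ltnP j k.
  rewrite (residual_poly_slope lij Eo) coef_poly [in RHS]ifF; last lia.
  case: ltnP => k5; rewrite ?mulr0z //; apply/eqP; rewrite intr_F3_eq0.
  have := side_v3ge hneg Eo (_ : (k < size f)%N); rewrite size_quartic => /(_ k5).
  by rewrite EB // (leqNgt k) jk andbF /= v3ge_split.
rewrite ifT; last lia.
by apply/esym/(residual_coef (mu := mu)) => //; rewrite ?ik ?kj // EB //; lia.
Qed.
End QuarticSides.

Lemma v3ge_cancel m n (x : int) : v3ge (n + m) (x * 3 ^+ m) = v3ge n x.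
Proof. by rewrite addnC mulrC v3ge_split. Qed.

Section InseparableSides.
Variables (a b c : int).
Notation f := (quartic a b c).
Notation A := (taylor_coef f).
Notation o := (ordinate f).

Lemma regularPn s i j : is_neg_side f s i j -> (i < 5)%N -> (j < 5)%N ->
  ~~ separable_poly (residual_poly f s i j) -> irregular f s.
Proof. by move=> h i5 j5; apply: contraNN => /regular_side; apply. Qed.

Lemma taylor_coef3 s : A s 3 = 4 * s. Proof. by rewrite taylor_coef_quartic. Qed.
Lemma taylor_coef4 s : A s 4 = 1. Proof. by rewrite taylor_coef_quartic. Qed.
Lemma taylor_coef0 s : A s 0 = f.[s]. Proof. by rewrite /taylor_coef nderivn0. Qed.
Lemma taylor_coef1 s : A s 1 = f^`().[s]. Proof. by rewrite /taylor_coef nderivn1. Qed.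

Lemma taylor_coef3_unit s : ~~ (3 %| s)%Z -> ~~ (3 %| A s 3)%Z.
Proof. by move=> hs; rewrite taylor_coef3 Euclid3. Qed.

Lemma unit3_neq0 (x : int) : ~~ (3 %| x)%Z -> x != 0.
Proof. by apply: contraNneq => ->. Qed.

Lemma ordinate3 s : ~~ (3 %| s)%Z -> o s 3 = 0%N.
Proof. by move=> hs; apply: (@logn3_eq _ (A s 3)); rewrite ?mul1r // taylor_coef3_unit. Qed.

Lemma ord_exact s k n u : A s k = 3 ^+ n * u -> ~~ (3 %| u)%Z -> o s k = n.
Proof. exact: logn3_eq. Qed.

Lemma neg_side_v3ge s i j mu n k : is_neg_side f s i j ->
    (o s i = o s j + mu * (j - i))%N -> (k < 5)%N ->
    (n + mu * k <= o s i + mu * i + ~~ (i <= k <= j))%N ->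
  v3ge n (A s k).
Proof.
move=> hneg Eo k5 le; rewrite -(v3ge_cancel (mu * k)).
by apply: v3ge_le le; apply: side_v3ge => //; rewrite size_quartic.
Qed.

(** The three positions of an inseparable side, with what they say about the
valuations of the Taylor coefficients. *)
Lemma irregular_cases s : ~~ (3 %| s)%Z -> irregular f s -> exists2 mu, (0 < mu)%N &
  [\/ [/\ A s 0 != 0, o s 0 = (3 * mu)%N, v3ge (2 * mu) (A s 1) & v3ge mu (A s 2)],
      [/\ A s 1 != 0, o s 1 = (2 * mu)%N, v3ge (3 * mu + 1) (A s 0) & v3ge mu (A s 2)]
    | [/\ A s 0 != 0, A s 2 != 0, o s 0 = (o s 2 + 2 * mu)%N, (o s 2 < mu)%N
        & v3ge (o s 2 + mu) (A s 1)]].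
Proof.
move=> hs /irregular_side[i [j [i5 j5 hneg hsep]]].
have [mu [mu0 Eo hij]] := inseparable_slope hs hneg hsep.
have D n k := @neg_side_v3ge s i j mu n k hneg Eo.
have [/is_sideP[lij Ai Aj _] _] := andP hneg.
exists mu => //; move: hij; rewrite !inE => /or3P[] /eqP[Ei Ej]; subst i j.
- apply: Or31; rewrite ordinate3 // in Eo D *; split=> //; first by lia.
  + by apply: D => //; lia.
  by apply: D => //; lia.
- apply: Or32; rewrite ordinate3 // in Eo D *; split=> //; first by lia.
  + by apply: D => //; lia.
  by apply: D => //; lia.
apply: Or33; split=> //; first by lia.
- rewrite ltnNge; apply: contraNN (taylor_coef3_unit hs) => le.
  have : v3ge 1 (A s 3) by apply: D => //; lia.
  by [].
by apply: D => //; lia.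
Qed.

Lemma residual_coef_above s i j mu k : ~~ (3 %| s)%Z -> is_neg_side f s i j ->
    (o s i = o s j + mu * (j - i))%N -> (i <= k <= j)%N ->
    v3ge (o s i + mu * i + 1) (A s k * 3 ^+ (mu * k)) ->
  (residual_poly f s i j)`_(k - i) = 0.
Proof.
move=> hs hneg Eo hk /dvdzP[B EB].
rewrite (@residual_coef _ _ _ _ _ _ mu _ (B * 3)) //.
  by apply/eqP; rewrite intr_F3_eq0 dvdz_mull.
by rewrite EB addn1 exprSr mulrCA.
Qed.

Lemma residual_coef_on s i j mu k : ~~ (3 %| s)%Z -> is_neg_side f s i j ->
    (o s i = o s j + mu * (j - i))%N -> (i <= k <= j)%N ->
    A s k != 0 -> (o s k + mu * k = o s i + mu * i)%N ->
  (residual_poly f s i j)`_(k - i) != 0.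
Proof.
move=> hs hneg Eo hk Ak Ek; have [u Eu hu] := v3ge_exact Ak.
rewrite (@residual_coef _ _ _ _ _ _ mu _ u) ?intr_F3_eq0 //.
by rewrite {1}Eu mulrAC -exprD -/(o s k) Ek.
Qed.

(** When A_2 is so divisible that it never contributes to the polygon, a
residual polynomial is linear, c_1 + c_3 y^2 or c_0 + c_1 y + c_3 y^3; only the
last one can be inseparable, and it is exactly when c_1 = 0. *)
Lemma irregular_triple s : ~~ (3 %| s)%Z -> A s 0 != 0 -> (0 < o s 0)%N ->
    (forall j, v3ge (2 * j) (A s 1) -> v3ge (3 * j) (A s 0) -> v3ge (j + 1) (A s 2)) ->
  irregular f s <-> exists2 k, o s 0 = (3 * k)%N & v3ge (2 * k + 1) (A s 1).
Proof.
move=> hs A0N o0 U; split=> [irr|[k Eo0 h1]].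
  have [i [j [i5 j5 hneg hsep]]] := irregular_side irr.
  have [mu [mu0 Eo hij]] := inseparable_slope hs hneg hsep.
  have D n k := @neg_side_v3ge s i j mu n k hneg Eo.
  have [/is_sideP[lij Ai Aj _] _] := andP hneg.
  move: hij; rewrite !inE => /or3P[] /eqP[Ei Ej]; subst i j.
  - have Eo' := Eo; rewrite ordinate3 // in Eo'; exists mu; first by lia.
    have h1 : v3ge (2 * mu) (A s 1) by apply: D => //; lia.
    have h2 : v3ge (mu + 1) (A s 2) by apply: U; rewrite // v3ge_logn // -/(o s 0); lia.
    apply: contraNT hsep => hn1; apply: separable_F3_deg1.
    + exact: (size_residual hs hneg (mu := mu)).
    + apply: (residual_coef_above hs hneg Eo (k := 2)) => //.
      by apply: v3ge_le (v3geM h2 (v3geX (mu * 2) v3ge_3)) _; lia.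
    + have A1N : A s 1 != 0 by apply: contraNneq hn1 => ->; rewrite /v3ge dvdz0.
      apply: (residual_coef_on hs hneg Eo (k := 1)) => //.
      by move: h1 hn1; rewrite !v3ge_logn // -!/(o s 1); lia.
  - have Eo' := Eo; rewrite ordinate3 // in Eo'; have h0 : v3ge (3 * mu) (A s 0) by apply: D => //; lia.
    have h2 : v3ge (mu + 1) (A s 2) by apply: U; rewrite // v3ge_logn // -/(o s 1); lia.
    case/negP: hsep; rewrite separable_F3_deg2.
    + rewrite (residual_coef_above hs hneg Eo (k := 2)) //; last first.
        by apply: v3ge_le (v3geM h2 (v3geX (mu * 2) v3ge_3)) _; lia.
      rewrite mul0r rootE horner_coef0.
      exact: (residual_coef_on hs hneg Eo (k := 1)).
    + exact: (size_residual hs hneg (mu := mu)).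
    by apply: (residual_coef_on hs hneg Eo (k := 3)) => //; rewrite ordinate3 //; lia.
  have l2 : (o s 2 < mu)%N.
    rewrite ltnNge; apply: contraNN (taylor_coef3_unit hs) => le.
    have : v3ge 1 (A s 3) by apply: D => //; lia.
    by [].
  have h1 : v3ge (2 * o s 2) (A s 1) by apply: D => //; lia.
  have : v3ge (o s 2 + 1) (A s 2) by apply: U; rewrite // v3ge_logn // -/(o s 0); lia.
  by rewrite v3ge_logn // -/(o s 2); lia.
have k0 : (0 < k)%N by lia.
have A3N := unit3_neq0 (taylor_coef3_unit hs).
have h0 : v3ge (3 * k) (A s 0) by rewrite v3ge_logn // -/(o s 0); lia.
have h2 : v3ge (k + 1) (A s 2) by apply: U => //; apply: v3ge_le h1 _; lia.
have hneg : is_neg_side f s 0 3.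
  apply: (@neg_sideI _ _ _ _ k (3 * k)) => //; try by rewrite ?ordinate3; lia.
  rewrite size_quartic; case=> [|[|[|[|[|k']]]]] //= _; v3ge_auto.
have Eo : o s 0 = (o s 3 + k * (3 - 0))%N by rewrite ordinate3 //; lia.
apply: (regularPn hneg) => //; apply: inseparable_F3_deg0.
- rewrite (size_residual hs hneg Eo) andbT.
  have : (residual_poly f s 0 3)`_3 != 0.
    by apply: (residual_coef_on hs hneg Eo (k := 3)) => //; rewrite ordinate3 //; lia.
  by apply: contraNltn => h; rewrite nth_default // (leq_trans h).
- by apply: (residual_coef_above hs hneg Eo (k := 2)) => //; rewrite Eo0; v3ge_auto.
by apply: (residual_coef_above hs hneg Eo (k := 1)) => //; rewrite Eo0; v3ge_auto.
Qed.
End InseparableSides.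

(** * One step of the iteration *)

Section IterationStep.
Variables (a b c : int).
Notation f := (quartic a b c).
Notation A := (taylor_coef f).
Notation o := (ordinate f).

Lemma taylor_horner s h :
  f.[s + h] = A s 0 + A s 1 * h + A s 2 * h ^+ 2 + A s 3 * h ^+ 3 + h ^+ 4.
Proof.
rewrite !taylor_coef_quartic /= /quartic !hornerE /=; ring.
Qed.

Lemma taylor_deriv s h :
  f^`().[s + h] = A s 1 + 2 * A s 2 * h + 3 * A s 3 * h ^+ 2 + 4 * h ^+ 3.
Proof.
rewrite -taylor_coef1 !taylor_coef_quartic /=; ring.
Qed.

(** A double root y of the residual polynomial makes both f and its derivative
at s + y 3^mu more divisible by 3 than the line of the side predicts. *)
Lemma iteration_step_shape s t : ~~ (3 %| s)%Z -> iteration_step f s t ->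
  exists i j mu (y : int), [/\ is_neg_side f s i j, (0 < mu)%N,
    (o s i = o s j + mu * (j - i))%N /\ (i, j) \in [:: (0, 3); (1, 3); (0, 2)]%N,
    t = s + y * 3 ^+ mu &
    v3ge (o s i + mu * i + 1) f.[t] /\ v3ge (o s i + mu * i + 1) (f^`().[t] * 3 ^+ mu)].
Proof.
move=> hs [i [j [mu [y [hneg hsep Emu hy Et]]]]].
have [mu' [mu0 Eo hij]] := inseparable_slope hs hneg hsep.
have [hside _] := andP hneg; have [lij _ _ _] := is_sideP hside.
have Em : mu = mu'.
  have : (mu * (j - i) = mu' * (j - i))%N by rewrite -Emu Eo addKn.
  by move/eqP; rewrite eqn_pmul2r ?subn_gt0 // => /eqP.
subst mu'; exists i, j, mu, y; split=> //.
have [g [sg Eg gR]] := residual_reduction hs hneg Eo.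
have : ('X - (y%:~R)%:P) ^+ 2 %| 'X^i * residual_poly f s i j by rewrite dvdp_mull.
rewrite -gR => /double_root_F3; rewrite deriv_map !rootE !horner_map /= => -[].
rewrite !intr_F3_eq0; set E := (o s i + mu * i)%N in Eg *.
have -> : g.[y] = g`_0 + g`_1 * y + g`_2 * y ^+ 2 + g`_3 * y ^+ 3 + g`_4 * y ^+ 4.
  rewrite (horner_coef_wide _ sg) !big_ord_recl big_ord0 /= /bump /=.
  by rewrite !exprS !expr0 /=; ring.
have -> : g^`().[y] = g`_1 + 2 * g`_2 * y + 3 * g`_3 * y ^+ 2 + 4 * g`_4 * y ^+ 3.
  have sg' : (size g^`() <= 4)%N by rewrite /deriv; apply: leq_trans (size_poly _ _) _; lia.
  rewrite (horner_coef_wide _ sg') !big_ord_recl big_ord0 /= /bump /= !coef_deriv.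
  by rewrite !exprS !expr0 /=; ring.
move=> r0 r1; rewrite Et taylor_horner taylor_deriv.
have E0 := Eg 0%N; have E1 := Eg 1%N; have E2 := Eg 2; have E3 := Eg 3; have E4 := Eg 4.
rewrite taylor_coef4 in E4; rewrite !exprM in E0 E1 E2 E3 E4.
move: E0 E1 E2 E3 E4 r0 r1; rewrite /v3ge exprD.
move: (A s 0) (A s 1) (A s 2) (A s 3) (g`_0) (g`_1) (g`_2) (g`_3) (g`_4).
move=> A0 A1 A2 A3 B0 B1 B2 B3 B4.
move: (3 ^+ mu) (3 ^+ E) => h e.
rewrite !mul1r !expr0 expr1 !mulr1 => E0 E1 E2 E3 E4 /dvdzP[q0 r0] /dvdzP[q1 r1].
split; apply/dvdzP.
  exists q0; transitivity (e * (B0 + B1 * y + B2 * y ^+ 2 + B3 * y ^+ 3 + B4 * y ^+ 4)).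
    rewrite !mulrDr -E0 !(mulrA e) -E1 -E2 -E3 -E4; ring.
  by rewrite r0; ring.
exists q1; transitivity (e * (B1 + 2 * B2 * y + 3 * B3 * y ^+ 2 + 4 * B4 * y ^+ 3)).
  transitivity (e * B1 + 2 * (e * B2) * y + 3 * (e * B3) * y ^+ 2 + 4 * (e * B4) * y ^+ 3).
    by rewrite -E1 -E2 -E3 -E4; ring.
  by ring.
by rewrite r1; ring.
Qed.
End IterationStep.

(** * Steep expansions: termination and the regular limit *)

Section Steep.
Variables (a b c : int).
Notation f := (quartic a b c).
Notation A := (taylor_coef f).
Notation o := (ordinate f).

(** The polygon passes through (2, k), has slope at least k in absolute value
on its left, and lies on or above the line of slope -n/2 through (2, k).  The
number n measures the progress of the iteration. *)
Definition steep (k n : nat) (s : int) : Prop :=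
  [/\ ~~ (3 %| s)%Z, exists2 u, A s 2 = 3 ^+ k * u & ~~ (3 %| u)%Z,
      (2 * k <= n)%N, v3ge (k + n) (A s 0) & v3ge (k + (n + 1) %/ 2) (A s 1)].

Lemma disc_taylor s :
  quartic_disc a b c = taylor_disc (A s 0) (A s 1) (A s 2) (A s 3).
Proof. by rewrite (quartic_disc_taylor a b c s) !taylor_coef_quartic. Qed.

Lemma steep_disc k n s : steep k n s -> v3ge (4 * k + n) (quartic_disc a b c).
Proof.
case=> hs [u Eu hu] kn h0 h1; rewrite (disc_taylor s).
have h2 : v3ge k (A s 2) by rewrite Eu /v3ge dvdz_mulr.
by apply: taylor_disc_state h0 h1 h2 => //; lia.
Qed.

Lemma taylor_second s h : A (s + h) 2 = A s 2 + 3 * A s 3 * h + 6 * h ^+ 2.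
Proof. by rewrite !taylor_coef_quartic /=; ring. Qed.

(** The inseparable side contains the point (2, k), whichever of the three
positions it has; hence its line is the one of slope -mu through (2, k) with
n <= 2 mu, and the step gains at least one half in slope. *)
Lemma steep_step k n s t : steep k n s -> iteration_step f s t ->
  exists2 n', (n < n')%N & steep k n' t.
Proof.
case=> hs [u Eu hu] kn h0 h1 /(iteration_step_shape hs).
case=> i [j [mu [y [hneg mu0 [Eo hij] Et [t0 t1]]]]].
have [/is_sideP[lij Ai Aj _] _] := andP hneg.
have D n' l := @neg_side_v3ge a b c s i j mu n' l hneg Eo.
have A2N : A s 2 != 0 by rewrite Eu mulf_neq0 ?expf_neq0 // unit3_neq0.
have o2 : o s 2 = k by apply: ord_exact Eu hu.
have [EE nmu] : (o s i + mu * i = k + 2 * mu)%N /\ (n <= 2 * mu)%N.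
  move: hij; rewrite !inE => /or3P[] /eqP[Ei Ej]; subst i j.
  - have : v3ge mu (A s 2) by apply: D => //; lia.
    move: h0; rewrite !v3ge_logn // -/(o s 0) -/(o s 2) o2.
    by rewrite ordinate3 // in Eo; lia.
  - have : v3ge mu (A s 2) by apply: D => //; lia.
    move: h1; rewrite !v3ge_logn // -/(o s 1) -/(o s 2) o2.
    by rewrite ordinate3 // in Eo; lia.
  by move: h0; rewrite v3ge_logn // -/(o s 0); rewrite o2 in Eo; lia.
have kmu : (k <= mu)%N by lia.
exists (2 * mu + 1)%N; first by lia.
have h3 : v3ge mu (y * 3 ^+ mu) by rewrite /v3ge dvdz_mull.
have h0' : ~~ (3 %| t)%Z.
  rewrite Et rpredDr //; apply: dvdz_mull.
  by rewrite -[X in (X %| _)%Z]expr1; apply: dvdz_exp2l.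
split=> //; last 2 first.
- by rewrite taylor_coef0; apply: v3ge_le t0 _; lia.
- by rewrite taylor_coef1 -(v3ge_cancel mu); apply: v3ge_le t1 _; lia.
- have /dvdzP[q Eq] : v3ge (k + 1) (3 * A s 3 * (y * 3 ^+ mu) + 6 * (y * 3 ^+ mu) ^+ 2).
    by move: h3; move: (y * _) => h h3; v3ge_auto.
  exists (u + q * 3); last by rewrite rpredDr // dvdz_mull.
  by rewrite Et taylor_second -addrA Eq Eu addn1 exprS; ring.
lia.
Qed.

Lemma irregular_step s : ~~ (3 %| s)%Z -> irregular f s -> exists t, iteration_step f s t.
Proof.
move=> hs /irregular_side[i [j [i5 j5 hneg hsep]]].
have [mu [mu0 Eo hij]] := inseparable_slope hs hneg hsep.
have [hside _] := andP hneg; have [lij _ Aj _] := is_sideP hside.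
have RN : residual_poly f s i j != 0.
  have : (residual_poly f s i j)`_(j - i) != 0.
    apply: (residual_coef_on hs hneg Eo) => //; first by rewrite leqnn ltnW.
    by rewrite Eo; nia.
  by apply: contraNneq => ->; rewrite coef0.
have [y hy] := inseparable_F3_root (size_residual hs hneg Eo) RN hsep.
exists (s + y * 3 ^+ mu), i, j, mu, y; split=> //.
by rewrite Eo addKn.
Qed.

(** The level n is bounded, as 3^(4k+n) divides the discriminant. *)
Lemma steep_terminates k n s (D : nat) : quartic_disc a b c != 0 ->
    logn 3 `|quartic_disc a b c| = D -> steep k n s -> iteration_terminates f s.
Proof.
move=> dN ED; have [m] := ubnP (D - n)%N.
elim: m n s => // m IHm n s lt hst.
have [r|irr] := boolP (regular f s); first exact: terminates_stop.
have [hs _ _ _ _] := hst.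
have hD : (4 * k + n <= D)%N by rewrite -ED -v3ge_logn //; apply: steep_disc hst.
apply: terminates_next => //; first exact: irregular_step.
move=> t /(steep_step hst)[n' lt' hst'].
have hD' : (4 * k + n' <= D)%N by rewrite -ED -v3ge_logn //; apply: steep_disc hst'.
by apply: IHm hst'; lia.
Qed.

Lemma steep_iteration k n s t : iteration f s t -> steep k n s ->
  regular f t /\ exists n', steep k n' t.
Proof.
move=> h; elim: h n => {s t} [s r n hst|s t r irr hstep _ IH n hst].
  by split=> //; exists n.
have [n' _ hst'] := steep_step hst hstep; exact: IH hst'.
Qed.

Lemma size_residual_length s i j mu : (i < j)%N ->
    (o s i = o s j + mu * (j - i))%N ->
  (size (residual_poly f s i j) <= (j - i).+1)%N.
Proof. by move=> lij Eo; rewrite (residual_poly_slope lij Eo) size_poly. Qed.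

(** Used with r the value of a residual polynomial at the candidate double
root, l a unit that clears denominators, and e a discriminant. *)
Lemma eq0_mod3 (e r t l : 'F_3) : l != 0 -> l * r = - e + 3 * t -> e = 0 -> r = 0.
Proof.
move=> lN H e0; apply: (mulfI lN).
by rewrite H e0 F3_3 mul0r oppr0 addr0 mulr0.
Qed.

Lemma v3ge_subl n (x y : int) : v3ge n x -> v3ge n (x - y) -> v3ge n y.
Proof. by move=> hx hy; rewrite -[y](subKr x) v3geD // v3geN. Qed.

Lemma taylor_disc_odd (A0 A1 A2 A3 : int) k m : (0 < k <= m)%N ->
    v3ge (k + (2 * m + 1)) A0 -> v3ge (k + m + 1) A1 -> v3ge k A2 ->
  v3ge (4 * k + (2 * m + 2)) (taylor_disc A0 A1 A2 A3 + 4 * A3 ^+ 2 * A2 ^+ 3 * A0).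
Proof.
move=> km h0 h1 h2.
have -> : taylor_disc A0 A1 A2 A3 + 4 * A3 ^+ 2 * A2 ^+ 3 * A0 =
  256 * A0 ^+ 3 - 192 * A3 * A1 * A0 ^+ 2 - 128 * A2 ^+ 2 * A0 ^+ 2
  + 144 * A2 * A1 ^+ 2 * A0 - 27 * A1 ^+ 4 + 144 * A3 ^+ 2 * A2 * A0 ^+ 2
  - 6 * A3 ^+ 2 * A1 ^+ 2 * A0 - 80 * A3 * A2 ^+ 2 * A1 * A0
  + 18 * A3 * A2 * A1 ^+ 3 + 16 * A2 ^+ 4 * A0 - 4 * A2 ^+ 3 * A1 ^+ 2
  - 27 * A3 ^+ 4 * A0 ^+ 2 + 18 * A3 ^+ 3 * A2 * A1 * A0
  - 4 * A3 ^+ 3 * A1 ^+ 3 + A3 ^+ 2 * A2 ^+ 2 * A1 ^+ 2.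
  by rewrite /taylor_disc; ring.
by v3ge_auto.
Qed.

Lemma taylor_disc_even (A0 A1 A2 A3 : int) k m : (0 < k <= m)%N ->
    v3ge (k + 2 * m) A0 -> v3ge (k + m) A1 -> v3ge k A2 ->
  v3ge (4 * k + (2 * m + 1)) (taylor_disc A0 A1 A2 A3
     - (A3 ^+ 2 * A2 ^+ 2 * A1 ^+ 2 - 4 * A3 ^+ 3 * A1 ^+ 3 - 4 * A3 ^+ 2 * A2 ^+ 3 * A0)).
Proof.
move=> km h0 h1 h2.
have -> : taylor_disc A0 A1 A2 A3
     - (A3 ^+ 2 * A2 ^+ 2 * A1 ^+ 2 - 4 * A3 ^+ 3 * A1 ^+ 3 - 4 * A3 ^+ 2 * A2 ^+ 3 * A0) =
  256 * A0 ^+ 3 - 192 * A3 * A1 * A0 ^+ 2 - 128 * A2 ^+ 2 * A0 ^+ 2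
  + 144 * A2 * A1 ^+ 2 * A0 - 27 * A1 ^+ 4 + 144 * A3 ^+ 2 * A2 * A0 ^+ 2
  - 6 * A3 ^+ 2 * A1 ^+ 2 * A0 - 80 * A3 * A2 ^+ 2 * A1 * A0
  + 18 * A3 * A2 * A1 ^+ 3 + 16 * A2 ^+ 4 * A0 - 4 * A2 ^+ 3 * A1 ^+ 2
  - 27 * A3 ^+ 4 * A0 ^+ 2 + 18 * A3 ^+ 3 * A2 * A1 * A0.
  by rewrite /taylor_disc; ring.
by v3ge_auto.
Qed.

(** Suppose that 3^(4k+n+1) divides the discriminant.  If n is odd, the main
term of the discriminant is -4 A_3^2 A_2^3 A_0, so A_0 is more divisible than
required.  If n = 2m, write A_2 = 3^k u, A_1 = 3^(k+m) B_1 and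
A_0 = 3^(k+2m) B_0: then 3 divides the discriminant of the reduced polynomial
B_0 + B_1 y + u y^2 (+ A_3 y^3 when m = k).  Unless B_0 and B_1 both vanish
modulo 3, this reduced polynomial, or its quotient by y, is the residual
polynomial of a side and has a double root, against regularity. *)
Lemma steep_regular k n s : (0 < k)%N -> steep k n s -> regular f s ->
  v3ge (4 * k + n + 1) (quartic_disc a b c) -> steep k n.+1 s.
Proof.
move=> k0 [hs [u Eu hu] kn h0 h1] r hd.
suff [h0' h1'] : v3ge (k + n.+1) (A s 0) /\ v3ge (k + (n.+1 + 1) %/ 2) (A s 1).
  split=> //; [by exists u | by nlia].
have hA3 := @taylor_coef3_unit a b c s hs; have A3N := unit3_neq0 hA3.
have A2N : A s 2 != 0 by rewrite Eu mulf_neq0 ?expf_neq0 // unit3_neq0.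
have o2 : o s 2 = k by apply: ord_exact Eu hu.
have h2 : v3ge k (A s 2) by rewrite Eu /v3ge dvdz_mulr.
have uN : (u%:~R : 'F_3) != 0 by rewrite intr_F3_eq0.
rewrite (disc_taylor s) in hd.
have [m [Em|Em]] : exists m, n = (2 * m + 1)%N \/ n = (2 * m)%N.
  by exists (n %/ 2)%N; nlia.
  subst n; have h1' : v3ge (k + m + 1) (A s 1) by apply: v3ge_le h1 _; nlia.
  split; last by apply: v3ge_le h1' _; nlia.
  have km : (0 < k <= m)%N by nlia.
  have := taylor_disc_odd (A s 3) km h0 h1' h2.
  rewrite /v3ge rpredDl; last by apply: v3ge_le hd _; nlia.
  have -> : (4 * k + (2 * m + 2) = 3 * k + (k + (2 * m).+2))%N by nlia.
  have -> : 4 * A s 3 ^+ 2 * A s 2 ^+ 3 * A s 0 =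
    3 ^+ (3 * k) * (4 * A s 3 ^+ 2 * u ^+ 3 * A s 0).
    by rewrite Eu (mulnC 3) exprM; ring.
  move=> h; have := v3ge_split (3 * k) (k + (2 * m).+2) (4 * A s 3 ^+ 2 * u ^+ 3 * A s 0).
  rewrite {1}/v3ge h v3ge_gauss; first by move=> E; rewrite addn1 -/(v3ge _ _) -E.
  by rewrite !(Euclid3X, Euclid3) /= (negPf hA3) (negPf hu).
subst n; have km : (k <= m)%N by nlia.
have h1' : v3ge (k + m) (A s 1) by apply: v3ge_le h1 _; nlia.
have /dvdzP[B0 E0] := h0; have /dvdzP[B1 E1] := h1'.
rewrite mulrC in E0; rewrite mulrC in E1.
have [d Ed] : exists d, m = (k + d)%N by exists (m - k)%N; nlia.
have hZ : (u ^+ 2 * B1 ^+ 2 - 4 * A s 3 * B1 ^+ 3 * 3 ^+ d - 4 * u ^+ 3 * B0)%:~R = 0 :> 'F_3.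
  apply/eqP; rewrite intr_F3_eq0.
  have km' : (0 < k <= m)%N by nlia.
  have := v3ge_subl (v3ge_le hd _) (taylor_disc_even (A s 3) km' h0 h1' h2).
  have -> : A s 3 ^+ 2 * A s 2 ^+ 2 * A s 1 ^+ 2 - 4 * A s 3 ^+ 3 * A s 1 ^+ 3 -
     4 * A s 3 ^+ 2 * A s 2 ^+ 3 * A s 0 = 3 ^+ (4 * k + 2 * m) *
     (A s 3 ^+ 2 * (u ^+ 2 * B1 ^+ 2 - 4 * A s 3 * B1 ^+ 3 * 3 ^+ d - 4 * u ^+ 3 * B0)).
    rewrite E0 E1 Eu Ed; move: (A s 3) => A3.
    have -> : (4 * k + 2 * (k + d) = k * 6 + d * 2)%N by nlia.
    have -> : (k + (k + d) = k * 2 + d)%N by nlia.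
    have -> : (k + 2 * (k + d) = k * 3 + d * 2)%N by nlia.
    rewrite !exprD !exprM.
    by move: (3 ^+ k) (3 ^+ d) => x y; ring.
  rewrite !addnA v3ge_split /v3ge expr1 !(Euclid3X, Euclid3) (negPf hA3) /=; apply.
  exact: leqnn.
have A3u : ((A s 3)%:~R : 'F_3) != 0 by rewrite intr_F3_eq0.
have B1E : A s 1 * 3 ^+ (m * 1) = 3 ^+ (k + 2 * m) * B1.
  by rewrite E1 mulrAC -exprD (_ : k + 2 * m = k + m + m * 1)%N //; nlia.
have B0E : A s 0 * 3 ^+ (m * 0) = 3 ^+ (k + 2 * m) * B0.
  by rewrite E0 muln0 mulr1.
have B2E : A s 2 * 3 ^+ (m * 2) = 3 ^+ (k + 2 * m) * u.
  by rewrite Eu mulrAC -exprD (_ : k + 2 * m = k + m * 2)%N //; nlia.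
(* B_0 = 0 mod 3: the candidate is the side from 1 to 3, possible only if m = k. *)
have em : (((2 * m).+1 + 1) %/ 2 = m + 1)%N by nlia.
have [B0d|B0u] := boolP (3 %| B0)%Z.
  have h0' : v3ge (k + (2 * m).+1) (A s 0) by rewrite E0 -addn1 addnA v3ge_split.
  split => //; suff B1d : (3 %| B1)%Z.
    by rewrite em addnA E1 v3ge_split.
  apply: contraT => B1u.
  have A1N : A s 1 != 0 by rewrite E1 mulf_neq0 ?expf_neq0 // unit3_neq0.
  have o1 : o s 1 = (k + m)%N by apply: ord_exact E1 B1u.
  have [d0|d0] := posnP d; last first.
    case/negP: B1u; move/eqP: hZ; rewrite intr_F3_eq0 rpredBr; last by rewrite dvdz_mull.
    rewrite rpredBr; last by rewrite dvdz_mull // Euclid3X d0.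
    by rewrite !(Euclid3X, Euclid3) (negPf hu).
  have Emk : m = k by nlia.
  have hneg : is_neg_side f s 1 3.
    apply: (@neg_sideI _ _ _ _ k (3 * k)) => //; rewrite ?o1 ?ordinate3 //; try nlia.
    by rewrite size_quartic; case=> [|[|[|[|[|k']]]]] //= _; v3ge_auto.
  have Eo : o s 1 = (o s 3 + k * (3 - 1))%N by rewrite o1 ordinate3 //; nlia.
  have := regular_side r _ _ hneg => /(_ isT isT).
  have Rc k' B := @residual_coef a b c s 1 3 k k' B hs hneg Eo.
  have EE : (o s 1 + k * 1 = k + 2 * m)%N by nlia.
  rewrite EE Emk in Rc; rewrite Emk in B1E B2E.
  have R0 : (residual_poly f s 1 3)`_0 = B1%:~R by exact: (Rc 1%N).
  have R1 : (residual_poly f s 1 3)`_1 = u%:~R by exact: (Rc 2%N).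
  have R2 : (residual_poly f s 1 3)`_2 = (A s 3)%:~R.
    by apply: (Rc 3%N) => //; rewrite mulrC (_ : k + 2 * k = k * 3)%N //; nlia.
  rewrite separable_F3_deg2 ?R2 // ?(size_residual hs hneg Eo) // => /negP[].
  rewrite rootE (horner_coef_wide _ (size_residual_length _ Eo)) //.
  rewrite !big_ord_recl big_ord0 /= /bump /= R0 R1 R2 addr0.
  apply/eqP; apply: (@eq0_mod3 ((u ^+ 2 - 4 * A s 3 * B1)%:~R) _
    ((u ^+ 2 - A s 3 * B1)%:~R) _ A3u).
    by rewrite !(rmorphB, rmorphM, rmorphXn) /= !exprS expr0; field.
  apply/eqP; rewrite intr_F3_eq0; move/eqP: hZ; rewrite intr_F3_eq0 rpredBr; last first.
    by rewrite dvdz_mull.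
  rewrite d0 expr0 mulr1 (_ : _ - _ = B1 ^+ 2 * (u ^+ 2 - 4 * A s 3 * B1)); last by ring.
  by rewrite Euclid3 Euclid3X (negPf B1u).
(* B_0 is a unit: the side starts at abscissa 0 and ends at 3 or at 2. *)
exfalso.
have A0N : A s 0 != 0 by rewrite E0 mulf_neq0 ?expf_neq0 // unit3_neq0.
have o0 : o s 0 = (k + 2 * m)%N by apply: ord_exact E0 B0u.
have [d0|d0] := posnP d.
  have Emk : m = k by nlia.
  have hneg : is_neg_side f s 0 3.
    apply: (@neg_sideI _ _ _ _ k (3 * k)) => //; rewrite ?o0 ?ordinate3 //; try nlia.
    by rewrite size_quartic; case=> [|[|[|[|[|k']]]]] //= _; v3ge_auto.
  have Eo : o s 0 = (o s 3 + k * (3 - 0))%N by rewrite o0 ordinate3 //; nlia.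
  have := regular_side r _ _ hneg => /(_ isT isT).
  have Rc k' B := @residual_coef a b c s 0 3 k k' B hs hneg Eo.
  have EE : (o s 0 + k * 0 = k + 2 * m)%N by nlia.
  rewrite EE Emk in Rc; rewrite Emk in B0E B1E B2E.
  have R0 : (residual_poly f s 0 3)`_0 = B0%:~R by exact: (Rc 0%N).
  have R1 : (residual_poly f s 0 3)`_1 = B1%:~R by exact: (Rc 1%N).
  have R2 : (residual_poly f s 0 3)`_2 = u%:~R by exact: (Rc 2%N).
  have R3 : (residual_poly f s 0 3)`_3 = (A s 3)%:~R.
    by apply: (Rc 3%N) => //; rewrite mulrC (_ : k + 2 * k = k * 3)%N //; nlia.
  rewrite separable_F3_deg2 ?R2 // ?(size_residual hs hneg Eo) // => /negP[].
  rewrite rootE (horner_coef_wide _ (size_residual_length _ Eo)) //.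
  rewrite !big_ord_recl big_ord0 /= /bump /= R0 R1 R2 R3 addr0.
  have u3 : (u%:~R : 'F_3) ^+ 3 != 0 by rewrite expf_neq0.
  apply/eqP; apply: (eq0_mod3 (t := (u ^+ 2 * B1 ^+ 2 - A s 3 * B1 ^+ 3 - u ^+ 3 * B0)%:~R)
     u3 _ hZ).
  rewrite d0 expr0 mulr1 !(rmorphB, rmorphM, rmorphXn) /= !exprS expr0.
  by field.
have hneg : is_neg_side f s 0 2.
  apply: (@neg_sideI _ _ _ _ m (k + 2 * m)) => //; rewrite ?o0 ?o2 //; try nlia.
  by rewrite size_quartic; case=> [|[|[|[|[|k']]]]] //= _; v3ge_auto.
have Eo : o s 0 = (o s 2 + m * (2 - 0))%N by rewrite o0 o2; nlia.
have := regular_side r _ _ hneg => /(_ isT isT).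
have Rc k' B := @residual_coef a b c s 0 2 m k' B hs hneg Eo.
have EE : (o s 0 + m * 0 = k + 2 * m)%N by nlia.
rewrite EE in Rc.
have R0 : (residual_poly f s 0 2)`_0 = B0%:~R by exact: (Rc 0%N).
have R1 : (residual_poly f s 0 2)`_1 = B1%:~R by exact: (Rc 1%N).
have R2 : (residual_poly f s 0 2)`_2 = u%:~R by exact: (Rc 2%N).
rewrite separable_F3_deg2 ?R2 // ?(size_residual hs hneg Eo) // => /negP[].
rewrite rootE (horner_coef_wide _ (size_residual_length _ Eo)) //.
rewrite !big_ord_recl big_ord0 /= /bump /= R0 R1 R2 addr0.
apply/eqP; apply: (@eq0_mod3 ((B1 ^+ 2 - 4 * u * B0)%:~R) _
    ((B1 ^+ 2 - u * B0)%:~R) _ uN).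
  by rewrite !(rmorphB, rmorphM, rmorphXn) /= !exprS expr0; field.
apply/eqP; rewrite intr_F3_eq0; move/eqP: hZ; rewrite intr_F3_eq0.
rewrite (_ : _ - _ - _ = u ^+ 2 * (B1 ^+ 2 - 4 * u * B0) - 4 * A s 3 * B1 ^+ 3 * 3 ^+ d); last by ring.
rewrite rpredBr; last by rewrite dvdz_mull // Euclid3X d0.
by rewrite Euclid3 Euclid3X (negPf hu).
Qed.

Lemma steep_regular_max k n s (D : nat) : (0 < k)%N -> quartic_disc a b c != 0 ->
    logn 3 `|quartic_disc a b c| = D -> steep k n s -> regular f s ->
  exists2 n', (4 * k + n' = D)%N & steep k n' s.
Proof.
move=> k0 dN ED; have [m] := ubnP (D - n)%N.
elim: m n => // m IHm n lt hst r.
have hD : (4 * k + n <= D)%N by rewrite -ED -v3ge_logn //; apply: steep_disc hst.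
have [E|N] := eqVneq (4 * k + n)%N D; first by exists n.
apply: (IHm n.+1); rewrite ?ltnS //; first lia.
by apply: steep_regular; rewrite ?v3ge_logn ?ED //; lia.
Qed.
End Steep.

(** * Elements integral at 3 *)

(** Integrality over the localization of Z at 3, in any field; the field is
either the number field or the field of algebraic numbers. *)
Definition int3 (F : fieldType) (x : F) : Prop :=
  exists2 m : int, ~~ (3 %| m)%Z & integralOver (intr : int -> F) (m%:~R * x).

(** The radical of the ideal generated by 3: the elements of positive valuation
at all places above 3. *)
Definition rad3 (F : fieldType) (x : F) : Prop :=
  int3 x /\ exists n, int3 (x ^+ n / 3).

Lemma v3geSP n (x : int) : v3ge (n + 1) x -> exists q, x = q * 3 * 3 ^+ n.
Proof. by rewrite addn1 /v3ge exprS => /dvdzP[q ->]; exists q; rewrite mulrA. Qed.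

Section Int3.
Variable F : fieldType.
Implicit Types (x y z : F).

Lemma int3_int (n : int) : int3 (n%:~R : F).
Proof. by exists 1 => //; rewrite mul1r; apply: integral_id. Qed.

Lemma int3_common x y : int3 x -> int3 y -> exists m : int,
  [/\ ~~ (3 %| m)%Z, integralOver (intr : int -> F) (m%:~R * x)
    & integralOver (intr : int -> F) (m%:~R * y)].
Proof.
case=> m hm hx [n hn hy]; exists (m * n); split.
- by rewrite Euclid3 negb_or hm.
- by rewrite mulrC rmorphM mulrA; apply: integral_mul; [rewrite mulrC | apply: integral_id].
by rewrite rmorphM -mulrA; apply: integral_mul => //; apply: integral_id.
Qed.

Lemma int3D x y : int3 x -> int3 y -> int3 (x + y).
Proof.
move=> hx hy; have [m [hm mx my]] := int3_common hx hy.
by exists m => //; rewrite mulrDr; apply: integral_add.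
Qed.

Lemma int3N x : int3 x -> int3 (- x).
Proof. by case=> m hm hx; exists m => //; rewrite mulrN; apply: integral_opp. Qed.

Lemma int3B x y : int3 x -> int3 y -> int3 (x - y).
Proof. by move=> hx hy; apply: int3D => //; apply: int3N. Qed.

Lemma int3M x y : int3 x -> int3 y -> int3 (x * y).
Proof.
case=> m hm hx [n hn hy]; exists (m * n); first by rewrite Euclid3 negb_or hm.
by rewrite rmorphM mulrACA; apply: integral_mul.
Qed.

Lemma int3X x n : int3 x -> int3 (x ^+ n).
Proof.
move=> hx; elim: n => [|n IHn]; first exact: (int3_int 1).
by rewrite exprS; apply: int3M.
Qed.

Lemma int3_nat (n : nat) : int3 (n%:R : F).
Proof. by rewrite pmulrn; apply: int3_int. Qed.

Lemma int3_sum (I : Type) (r : seq I) (P : pred I) (f : I -> F) :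
  (forall i, P i -> int3 (f i)) -> int3 (\sum_(i <- r | P i) f i).
Proof.
by move=> hf; apply: big_ind => //; [exact: (int3_int 0) | exact: int3D].
Qed.

Lemma int3_prod (I : Type) (r : seq I) (P : pred I) (f : I -> F) :
  (forall i, P i -> int3 (f i)) -> int3 (\prod_(i <- r | P i) f i).
Proof.
by move=> hf; apply: big_ind => //; [exact: (int3_int 1) | exact: int3M].
Qed.

Lemma int3_det n (M : 'M[F]_n) : (forall i j, int3 (M i j)) -> int3 (\det M).
Proof.
move=> hM; apply: int3_sum => s _; apply: int3M; last exact: int3_prod.
by apply: int3X; apply: int3N; apply: (int3_int 1).
Qed.

Lemma int3_adj n (M : 'M[F]_n) i j : (forall i j, int3 (M i j)) -> int3 ((\adj M) i j).
Proof.
move=> hM; rewrite mxE /cofactor; apply: int3M.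
  by apply: int3X; apply: int3N; apply: (int3_int 1).
by apply: int3_det => k l; rewrite !mxE.
Qed.

Lemma integral_monic_relation (x : F) (s : seq F) : (forall y, y \in s -> integralOver (intr : int -> F) y) ->
  x ^+ size s = \sum_(i < size s) s`_i * x ^+ i -> integralOver (intr : int -> F) x.
Proof.
move=> hs Ex; pose p : {poly F} := 'X^(size s) - \poly_(i < size s) s`_i.
have sp : (size (- (\poly_(i < size s) s`_i)%R)%R < size ('X^(size s) : {poly F})%R)%N.
  by rewrite size_polyN size_polyXn ltnS size_poly.
apply: (@integral_root_monic _ _ _ _ p).
- by rewrite monicE /p lead_coefDl // lead_coefXn.
- by rewrite rootE /p hornerD hornerN hornerXn horner_poly Ex subrr.
apply/integral_poly => i; rewrite coefB coefXn coef_poly.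
apply: integral_sub; first exact: integral_nat.
by case: ltnP => hi; [apply: hs; apply: mem_nth | exact: integral0].
Qed.

Lemma int3_quadratic x y z : int3 y -> int3 z -> x ^+ 2 = y * x + z -> int3 x.
Proof.
move=> hy hz Ex; have [m [hm my mz]] := int3_common hy hz; exists m => //.
apply: (@integral_monic_relation _ [:: m%:~R * (m%:~R * z); m%:~R * y]).
  by move=> u; rewrite !inE => /orP[] /eqP->; [apply: integral_mul => //; apply: integral_id|].
by rewrite /= !big_ord_recl big_ord0 /= exprMn Ex; ring.
Qed.

Lemma int3_quartic x (b0 b1 b2 b3 : int) :
  x ^+ 4 = b0%:~R + b1%:~R * x + b2%:~R * x ^+ 2 + b3%:~R * x ^+ 3 -> int3 x.
Proof.
move=> Ex; exists 1 => //; rewrite mul1r.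
apply: (@integral_monic_relation _ [seq (b%:~R : F) | b : int <- [:: b0; b1; b2; b3]]).
  by move=> u /mapP[b' _ ->]; apply: integral_id.
by rewrite /= !big_ord_recl big_ord0 /= Ex; ring.
Qed.

Lemma rad3_int3 x : rad3 x -> int3 x. Proof. by case. Qed.

Lemma rad3M x y : int3 x -> rad3 y -> rad3 (x * y).
Proof.
move=> hx [hy [n hn]]; split; first exact: int3M.
by exists n; rewrite exprMn -mulrA; apply: int3M => //; apply: int3X.
Qed.

Lemma int3_pow_div x m k : int3 x -> int3 (x ^+ m / 3) -> (m <= k)%N -> int3 (x ^+ k / 3).
Proof.
by move=> hx hm le; rewrite -(subnK le) exprD -mulrA; apply: int3M => //; apply: int3X.
Qed.

Lemma rad3D x y : rad3 x -> rad3 y -> rad3 (x + y).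
Proof.
move=> [hx [m hm]] [hy [n hn]]; split; first exact: int3D.
exists (m + n)%N; rewrite exprDn mulr_suml; apply: int3_sum => i _.
rewrite -mulr_natl -mulrA; apply: int3M; first exact: int3_nat.
have [le|lt] := leqP n i.
  by rewrite -mulrA; apply: int3M; [apply: int3X | apply: int3_pow_div hn le].
rewrite mulrAC; apply: int3M; last exact: int3X.
by apply: int3_pow_div hm _ => //; lia.
Qed.

Lemma rad3N x : rad3 x -> rad3 (- x).
Proof. by rewrite -mulN1r => h; apply: rad3M => //; apply: int3N; apply: (int3_int 1). Qed.

Lemma rad3B x y : rad3 x -> rad3 y -> rad3 (x - y).
Proof. by move=> hx hy; apply: rad3D => //; apply: rad3N. Qed.

Lemma rad3_sqr x : int3 x -> rad3 (x ^+ 2) -> rad3 x.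
Proof. by move=> hx [_ [n hn]]; split=> //; exists (2 * n)%N; rewrite exprM. Qed.

Lemma rad3_quadratic x y z : rad3 y -> rad3 z -> x ^+ 2 = y * x + z -> rad3 x.
Proof.
move=> hy hz Ex; have hx := int3_quadratic (rad3_int3 hy) (rad3_int3 hz) Ex.
by apply: rad3_sqr => //; rewrite Ex; apply: rad3D => //; rewrite mulrC; apply: rad3M.
Qed.

Hypothesis nz3 : (3 : F) != 0.

Lemma rad3_3M x : int3 x -> rad3 (3 * x).
Proof.
move=> hx; split; first by apply: int3M => //; apply: int3_nat.
by exists 1%N; rewrite expr1 mulrAC divff // mul1r.
Qed.

Lemma rad3_int (n : int) : (3 %| n)%Z -> rad3 (n%:~R : F).
Proof.
by move=> /dvdzP[q ->]; rewrite mulrC rmorphM; apply: rad3_3M; apply: int3_int.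
Qed.

Lemma rad3_quartic x (b0 b1 b2 b3 : int) :
    (3 %| b0)%Z -> (3 %| b1)%Z -> (3 %| b2)%Z -> (3 %| b3)%Z ->
  x ^+ 4 = b0%:~R + b1%:~R * x + b2%:~R * x ^+ 2 + b3%:~R * x ^+ 3 -> rad3 x.
Proof.
move=> h0 h1 h2 h3 Ex; have hx := int3_quartic Ex.
do 2! (apply: rad3_sqr; first by try exact: int3X).
rewrite -exprM Ex; repeat apply: rad3D; first exact: rad3_int.
all: by rewrite mulrC; apply: rad3M; [try exact: int3X | apply: rad3_int].
Qed.
End Int3.

Section Quotients.
Variables (F : fieldType) (a b c s : int) (t : F).
Hypothesis nz3 : (3 : F) != 0.
Notation A := (taylor_coef (quartic a b c) s).
Hypothesis root_t : t ^+ 4 + a%:~R * t ^+ 2 + b%:~R * t + c%:~R = 0.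

(** With phi = t - s, these are the second and the third quotient in the
division of f by powers of phi: quot3 = (f(t) - f(s))/(t - s) formally, and
quot2 = (quot3 - A_1)/phi. *)
Definition quot2 : F := t ^+ 2 + (2 * s)%:~R * t + (3 * s ^+ 2 + a)%:~R.
Definition quot3 : F :=
  t ^+ 3 + s%:~R * t ^+ 2 + (s ^+ 2 + a)%:~R * t + (s ^+ 3 + a * s + b)%:~R.

Let castE := (rmorphD, rmorphB, rmorphM, rmorphXn).

Lemma quot3_phi : (t - s%:~R) * quot3 = - (A 0)%:~R.
Proof.
apply/eqP; rewrite -subr_eq0 opprK -root_t !taylor_coef_quartic /quot3 /= !castE /=; apply/eqP.
by ring.
Qed.

Lemma quot2E : quot2 = (t - s%:~R) ^+ 2 + (A 3)%:~R * (t - s%:~R) + (A 2)%:~R.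
Proof. by rewrite !taylor_coef_quartic /quot2 /= !castE /=; ring. Qed.

Lemma quot3E : quot3 = (t - s%:~R) * quot2 + (A 1)%:~R.
Proof. by rewrite !taylor_coef_quartic /quot2 /quot3 /= !castE /=; ring. Qed.

Lemma quot2_sqr : quot2 ^+ 2 = (A 2)%:~R * quot2 +
  ((A 3)%:~R * quot3 - (A 0)%:~R - (A 1)%:~R * (t + (3 * s)%:~R)).
Proof.
have -> : t + (3 * s)%:~R = (t - s%:~R) + (A 3)%:~R :> F.
  by rewrite !taylor_coef_quartic /= !castE /=; ring.
have key : (t - s%:~R) * ((t - s%:~R) * quot2 + (A 1)%:~R) = - (A 0)%:~R.
  by rewrite -quot3E quot3_phi.
have q3 := quot3E.
rewrite expr2 {1}quot2E; move: key q3; move: quot2 quot3 (t - s%:~R) => q2 q3 phi key ->.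
by rewrite -(opprK (A 0)%:~R) -key; ring.
Qed.

Lemma quot23 : quot2 * quot3 = - (A 0)%:~R * (t + (3 * s)%:~R) + (A 2)%:~R * quot3.
Proof.
have -> : t + (3 * s)%:~R = (t - s%:~R) + (A 3)%:~R :> F.
  by rewrite !taylor_coef_quartic /= !castE /=; ring.
by rewrite {1}quot2E -quot3_phi; ring.
Qed.

Lemma quot3_quartic : quot3 ^+ 4 = - (A 0 ^+ 3)%:~R + (A 3 * A 0 ^+ 2)%:~R * quot3
  - (A 2 * A 0)%:~R * quot3 ^+ 2 + (A 1)%:~R * quot3 ^+ 3.
Proof.
have e3 := quot3E; rewrite quot2E in e3.
have -> : quot3 ^+ 4 = quot3 ^+ 3 * quot3 by rewrite -exprSr.
rewrite {2}e3 !castE /=.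
have -> : (A 0)%:~R = - ((t - s%:~R) * quot3) by rewrite quot3_phi opprK.
by ring.
Qed.

Lemma int3_root : int3 t.
Proof.
apply: (@int3_quartic _ _ (- c) (- b) (- a) 0).
apply/eqP; rewrite -subr_eq0 -root_t; apply/eqP; rewrite !rmorphN /=; ring.
Qed.

Variables n1 n2 : nat.
Definition omega2 : F := quot2 / 3 ^+ n2.
Definition omega3 : F := quot3 / 3 ^+ n1.

Lemma omega3_quartic (b0 b1 b2 b3 : int) :
   A 0 ^+ 3 = b0 * 3 ^+ (4 * n1) -> A 3 * A 0 ^+ 2 = b1 * 3 ^+ (3 * n1) ->
   A 2 * A 0 = b2 * 3 ^+ (2 * n1) -> A 1 = b3 * 3 ^+ n1 ->
  omega3 ^+ 4 = (- b0)%:~R + b1%:~R * omega3 + (- b2)%:~R * omega3 ^+ 2 + b3%:~R * omega3 ^+ 3.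
Proof.
move=> E0 E1 E2 E3; rewrite /omega3 exprMn quot3_quartic E0 E1 E2 E3 !castE /= !rmorphN /=.
rewrite !(mulnC _ n1) !exprM -!exprVn.
have h : (3 : F) ^+ n1 != 0 by rewrite expf_neq0.
by rewrite exprVn; move: (3 ^+ n1) h quot3 => x h q; field.
Qed.

Lemma int3_omega3 : v3ge n1 (A 1) -> v3ge (2 * n1) (A 2 * A 0) -> v3ge (3 * n1) (A 3 * A 0 ^+ 2) ->
  v3ge (4 * n1) (A 0 ^+ 3) -> int3 omega3.
Proof.
move=> /dvdzP[b3 E3] /dvdzP[b2 E2] /dvdzP[b1 E1] /dvdzP[b0 E0].
exact: int3_quartic (omega3_quartic E0 E1 E2 E3).
Qed.

Lemma rad3_omega3 : v3ge (n1 + 1) (A 1) -> v3ge (2 * n1 + 1) (A 2 * A 0) ->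
  v3ge (3 * n1 + 1) (A 3 * A 0 ^+ 2) -> v3ge (4 * n1 + 1) (A 0 ^+ 3) -> rad3 omega3.
Proof.
move=> /v3geSP[b3 E3] /v3geSP[b2 E2] /v3geSP[b1 E1] /v3geSP[b0 E0].
by apply: (rad3_quartic nz3 _ _ _ _ (omega3_quartic E0 E1 E2 E3)); rewrite ?rpredN dvdz_mull.
Qed.

Lemma omega2_sqr (b2 b0 b1 : int) e : A 2 = b2 * 3 ^+ n2 -> A 0 = b0 * 3 ^+ (2 * n2) ->
   A 1 = b1 * 3 ^+ (2 * n2) -> n1 = (2 * n2 + e)%N ->
  omega2 ^+ 2 = b2%:~R * omega2 +
   ((A 3)%:~R * 3 ^+ e * omega3 - b0%:~R - b1%:~R * (t + (3 * s)%:~R)).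
Proof.
move=> E2 E0 E1 E; rewrite /omega2 /omega3 exprMn quot2_sqr E2 E0 E1 E !castE /=.
rewrite exprD (mulnC 2) exprM -!exprVn.
have h : (3 : F) ^+ n2 != 0 by rewrite expf_neq0.
have h' : (3 : F) ^+ e != 0 by rewrite expf_neq0.
by rewrite exprVn; move: (3 ^+ n2) (3 ^+ e) h h' quot2 quot3 => x y h h' q q'; field; rewrite h h'.
Qed.

Lemma int3_t3s : int3 (t + (3 * s)%:~R).
Proof. by apply: int3D; [exact: int3_root | exact: int3_int]. Qed.

Lemma int3_omega2 : v3ge n2 (A 2) -> v3ge (2 * n2) (A 0) -> v3ge (2 * n2) (A 1) ->
  (2 * n2 <= n1)%N -> int3 omega3 -> int3 omega2.
Proof.
move=> /dvdzP[b2 E2] /dvdzP[b0 E0] /dvdzP[b1 E1] /subnKC/esym E h3.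
apply: int3_quadratic (omega2_sqr E2 E0 E1 E); first exact: int3_int.
apply: int3B; last by apply: int3M; [exact: int3_int | exact: int3_t3s].
apply: int3B; last exact: int3_int.
apply: int3M => //; apply: int3M; [exact: int3_int | apply: int3X; exact: int3_nat].
Qed.

Lemma rad3_omega2 : v3ge (n2 + 1) (A 2) -> v3ge (2 * n2 + 1) (A 0) -> v3ge (2 * n2 + 1) (A 1) ->
  (2 * n2 <= n1)%N -> rad3 omega3 -> rad3 omega2.
Proof.
move=> /v3geSP[b2 E2] /v3geSP[b0 E0] /v3geSP[b1 E1] /subnKC/esym E h3.
apply: (rad3_quadratic _ _ (omega2_sqr E2 E0 E1 E)); first by apply: (rad3_int nz3); rewrite ?dvdz_mull.

apply: rad3B; last first.
  by rewrite mulrC; apply: rad3M; [exact: int3_t3s | apply: (rad3_int nz3); rewrite ?dvdz_mull].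
apply: rad3B; last by apply: (rad3_int nz3); rewrite ?dvdz_mull.
apply: rad3M => //; apply: int3M; [exact: int3_int | apply: int3X; exact: int3_nat].
Qed.
End Quotients.

(** * Algebraic numbers integral at 3 *)

Section AlgC.

Lemma nz3C : (3 : algC) != 0. Proof. by rewrite pnatr_eq0. Qed.

Lemma integralOver_Aint (x : algC) : integralOver (intr : int -> algC) x -> x \in Aint.
Proof.
case=> p mp rp; apply: root_monic_Aint rp _ _; first exact: monic_map.
by apply/polyOverP => i; rewrite coef_map /= intr_int.
Qed.

Lemma int3_divC (n : int) k : int3 (n%:~R / 3 ^+ k : algC) -> v3ge k n.
Proof.
case=> m hm /integralOver_Aint hA.
have p3 : (3 : algC) ^+ k != 0 by rewrite expf_neq0 ?nz3C.
have /Cint_rat_Aint/(_ hA)/intrP[z Ez] : m%:~R * (n%:~R / 3 ^+ k) \in Crat.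
  by rewrite rpredM ?rpred_div ?rpredX ?rpred_int ?rpred_nat.
rewrite -(v3ge_gauss _ _ hm); apply/dvdzP; exists z.
apply: (@intr_inj algC); rewrite !rmorphM rmorphXn /= -Ez.
by rewrite mulrA divfK.
Qed.

Lemma rad3_intC (n : int) : rad3 (n%:~R : algC) -> (3 %| n)%Z.
Proof.
case=> _ [k]; rewrite -[X in _ / X]expr1 -rmorphXn => /int3_divC.
by rewrite /v3ge expr1 Euclid3X => /andP[].
Qed.

Variables (a b c : int).
Definition rootC (t : algC) := t ^+ 4 + a%:~R * t ^+ 2 + b%:~R * t + c%:~R = 0.

Lemma rootsC : exists t1 t2 t3 t4 : algC,
  [/\ rootC t1, rootC t2, rootC t3 & rootC t4] /\
  [/\ t4 = - (t1 + t2 + t3),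
      a%:~R = t1 * t2 + t1 * t3 + t1 * t4 + t2 * t3 + t2 * t4 + t3 * t4,
      b%:~R = - (t1 * t2 * t3 + t1 * t2 * t4 + t1 * t3 * t4 + t2 * t3 * t4)
    & c%:~R = t1 * t2 * t3 * t4].
Proof.
pose p : {poly algC} := Poly [:: c%:~R; b%:~R; a%:~R; 0; 1].
have pE : p = [:: c%:~R; b%:~R; a%:~R; 0; 1] :> seq algC by rewrite (@PolyK _ 0) ?oner_eq0.
have [r Er] := closed_field_poly_normal p.
have lp : lead_coef p = 1 by rewrite lead_coefE pE.
rewrite lp scale1r in Er.
have sr : size r = 4.
  by have := size_prod_XsubC r id; rewrite -Er pE => -[].
case: r sr Er => [|t1 [|t2 [|t3 [|t4 [|]]]]] // _ Er.
have rt t : t \in [:: t1; t2; t3; t4] -> rootC t.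
  rewrite -root_prod_XsubC -Er rootE /p !horner_Poly /= => /eqP H.
  by rewrite /rootC -H; ring.
exists t1, t2, t3, t4; split; first by split; apply: rt; rewrite !inE eqxx ?orbT.
have {}Er : p = Poly [:: t1 * t2 * t3 * t4;
   - (t1 * t2 * t3 + t1 * t2 * t4 + t1 * t3 * t4 + t2 * t3 * t4);
   t1 * t2 + t1 * t3 + t1 * t4 + t2 * t3 + t2 * t4 + t3 * t4; - (t1 + t2 + t3 + t4); 1].
  rewrite Er !big_cons big_nil /= !cons_poly_def.
  rewrite !(polyCN, polyCD, polyCM); ring.
clearbody p.
have E i : p`_i = _ := congr1 (fun q : {poly algC} => q`_i) Er.
rewrite (@PolyK _ 0) ?oner_eq0 // in E.
have := E 0%N; have := E 1%N; have := E 2%N; have := E 3%N; rewrite pE /= => e3 e2 e1 e0.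
split=> //; apply/eqP; rewrite -subr_eq0; apply/eqP; move: e3 => /(congr1 -%R).
by rewrite oppr0 opprK => ->; ring.
Qed.
End AlgC.

(** * Saturation of the lattice at 3 *)

Lemma quartic_disc_roots (R : comNzRingType) (t1 t2 t3 : R) :
  let t4 := - (t1 + t2 + t3) in
  ((t2 - t1) * (t3 - t1) * (t4 - t1) * (t3 - t2) * (t4 - t2) * (t4 - t3)) ^+ 2 =
  quartic_disc (t1 * t2 + t1 * t3 + t1 * t4 + t2 * t3 + t2 * t4 + t3 * t4)
    (- (t1 * t2 * t3 + t1 * t2 * t4 + t1 * t3 * t4 + t2 * t3 * t4)) (t1 * t2 * t3 * t4).
Proof. 
move=> t4; rewrite /t4 {t4}/quartic_disc.
have -> : t1 * t2 + t1 * t3 + t1 * - (t1 + t2 + t3) + t2 * t3 + t2 * - (t1 + t2 + t3) +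
  t3 * - (t1 + t2 + t3) = - (t1 ^+ 2 + t2 ^+ 2 + t3 ^+ 2 + t1 * t2 + t1 * t3 + t2 * t3) by ring.
have -> : - (t1 * t2 * t3 + t1 * t2 * - (t1 + t2 + t3) +
     t1 * t3 * - (t1 + t2 + t3) + t2 * t3 * - (t1 + t2 + t3)) = (t1 + t2) * (t1 + t3) * (t2 + t3).
  by ring.
ring.
Qed.

Lemma quartic_disc_intr (R : comNzRingType) (a b c : int) :
  (quartic_disc a b c)%:~R = quartic_disc (a%:~R : R) b%:~R c%:~R.
Proof. by rewrite /quartic_disc !(rmorph_nat, rmorphXn, rmorphM, rmorphB, rmorphD). Qed.

Section Maximality.
Variables (a b c s : int) (n1 n2 : nat).
Notation A := (taylor_coef (quartic a b c) s).
Notation w2 t := (omega2 a s t n2).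
Notation w3 t := (omega3 a b s t n1).

Definition comb (F : fieldType) (t : F) (m0 m1 m2 m3 : int) : F :=
  m0%:~R + m1%:~R * t + m2%:~R * w2 t + m3%:~R * w3 t.

(** No new integral element arises by dividing a combination by 3.  The
hypothesis bears on all the conjugates, so that their symmetric functions can
be used. *)
Definition saturated3 : Prop := forall m0 m1 m2 m3 : int,
  (forall t : algC, rootC a b c t -> int3 (comb t m0 m1 m2 m3 / 3)) ->
  [/\ (3 %| m0)%Z, (3 %| m1)%Z, (3 %| m2)%Z & (3 %| m3)%Z].

Lemma rad3_3C (x : algC) : int3 (x / 3) -> rad3 x.
Proof.
by move=> h; rewrite -[x](divfK nz3C) mulrC; apply: rad3_3M; first exact: nz3C.
Qed.

(** The sum of the products of three conjugates of t is -b, a unit at 3. *)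
Lemma rad3_mul_root (n : int) : ~~ (3 %| b)%Z ->
  (forall t : algC, rootC a b c t -> rad3 (n%:~R * t)) -> (3 %| n)%Z.
Proof.
move=> hb H; have [t1 [t2 [t3 [t4 [[r1 r2 r3 r4] [_ _ Eb _]]]]]] := rootsC a b c.
have {}H1 := H _ r1; have H2 := H _ r2; have H3 := H _ r3; have H4 := H _ r4.
have : rad3 ((n ^+ 3 * b)%:~R : algC).
  have -> : (n ^+ 3 * b)%:~R = - ((n%:~R * t1) * (n%:~R * t2) * (n%:~R * t3)
     + (n%:~R * t1) * (n%:~R * t2) * (n%:~R * t4)
     + (n%:~R * t1) * (n%:~R * t3) * (n%:~R * t4)
     + (n%:~R * t2) * (n%:~R * t3) * (n%:~R * t4)) :> algC.
    by rewrite rmorphM rmorphXn /= Eb; ring.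
  apply: rad3N.
  have M x y z : rad3 x -> rad3 y -> rad3 z -> rad3 (x * y * z : algC).
    by move=> /rad3_int3 hx /rad3_int3 hy hz; apply: rad3M => //; apply: int3M.
  by do ![apply: rad3D]; apply: M.
by move/rad3_intC; rewrite Euclid3 Euclid3X (negPf hb) orbF.
Qed.

(** The totally ramified case: v_3(A_0) = n1 + n2 + 1 is prime to 3, and n1, n2
are the integral parts of two thirds and one third of it. *)
Section Ramified.
Hypothesis hb : ~~ (3 %| b)%Z.
Variable B0 : int.
Hypothesis EB0 : A 0 = B0 * 3 ^+ (n1 + n2 + 1).
Hypothesis hB0 : ~~ (3 %| B0)%Z.
Hypothesis h1 : v3ge (n1 + 1) (A 1).
Hypothesis h2 : v3ge (n2 + 1) (A 2).
Hypothesis n12 : (2 * n2 <= n1 <= 2 * n2 + 1)%N.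

Let h0 : v3ge (n1 + n2 + 1) (A 0). Proof. by rewrite EB0 /v3ge dvdz_mull. Qed.

Lemma rad3_omega3C t : rootC a b c t -> rad3 (w3 t).
Proof. by move=> rt; apply: rad3_omega3 rt _ _ _ _ _; rewrite ?nz3C //; v3ge_auto. Qed.

Lemma rad3_omega2C t : rootC a b c t -> rad3 (w2 t).
Proof.
move=> rt; apply: (rad3_omega2 nz3C rt) (rad3_omega3C rt) => //; try v3ge_auto; lia.
Qed.

(** From q_2 q_3 = -A_0 (t + 3s) + A_2 q_3. *)
Lemma omega23 t : rootC a b c t -> exists q : int,
  w2 t * w3 t / 3 = - B0%:~R * (t + (3 * s)%:~R) + q%:~R * w3 t.
Proof.
move=> rt; have /dvdzP[q Eq] := h2; exists q.
rewrite /omega2 /omega3.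
have -> : quot2 a s t / 3 ^+ n2 * (quot3 a b s t / 3 ^+ n1) / 3 =
   quot2 a s t * quot3 a b s t / 3 ^+ (n1 + n2 + 1).
  rewrite addn1 exprS exprD.
  have p1 : (3 : algC) ^+ n1 != 0 by rewrite expf_neq0 ?nz3C.
  have p2 : (3 : algC) ^+ n2 != 0 by rewrite expf_neq0 ?nz3C.
  by move: (3 ^+ n1) (3 ^+ n2) p1 p2 (quot2 _ _ _) (quot3 _ _ _ _) => x y hx hy u v; field; rewrite hx hy.
rewrite (quot23 s rt) EB0 Eq !rmorphM !rmorphXn /= !addn1 !exprS exprD.
have p1 : (3 : algC) ^+ n1 != 0 by rewrite expf_neq0 ?nz3C.
have p2 : (3 : algC) ^+ n2 != 0 by rewrite expf_neq0 ?nz3C.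
by move: (3 ^+ n1) (3 ^+ n2) p1 p2 (quot3 _ _ _ _) => x y hx hy v; field; rewrite hx hy.
Qed.

Lemma rad3_mul_omega23 (n : int) :
  (forall t : algC, rootC a b c t -> rad3 (n%:~R * (w2 t * w3 t / 3))) -> (3 %| n)%Z.
Proof.
move=> H; have : (3 %| n * B0)%Z.
  apply: (rad3_mul_root hb) => t rt; have [q Eq] := omega23 rt.
  have -> : (n * B0)%:~R * t = - (n%:~R * (w2 t * w3 t / 3))
      + (n * q)%:~R * w3 t - (3 * (n * B0 * s)%:~R).
    by rewrite Eq !rmorphM /=; ring.
  apply: rad3B; last by apply: rad3_3M; [exact: nz3C | exact: int3_int].
  apply: rad3D; first by apply: rad3N; exact: H.
  by apply: rad3M; [exact: int3_int | exact: rad3_omega3C].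
by rewrite Euclid3 (negPf hB0) orbF.
Qed.

(** At the ramified place omega_2 and omega_3 have valuations 1/3 and 2/3 when
n1 = 2 n2, and 2/3 and 1/3 otherwise; the square of the one of valuation 2/3 is
still in the radical after division by 3. *)
Lemma rad3_omega3_sqr t : n1 = (2 * n2)%N -> rootC a b c t -> rad3 (w3 t ^+ 2 / 3).
Proof.
move=> En rt.
have e1 : v3ge (n1 + 1) (A 1) by [].
have /v3geSP[b3 E3] := e1.
have /v3geSP[b2 E2] : v3ge (2 * n1 + 1 + 1) (A 2 * A 0) by v3ge_auto.
have /v3geSP[b1 E1] : v3ge (3 * n1 + 1 + 1) (A 3 * A 0 ^+ 2) by v3ge_auto.
have /v3geSP[b0 E0] : v3ge (4 * n1 + 1 + 1 + 1) (A 0 ^+ 3) by v3ge_auto.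
have s1 (x : int) n : x * 3 ^+ (n + 1) = x * 3 * 3 ^+ n by rewrite addn1 exprS mulrA.
rewrite !s1 in E0 E1 E2.
have := omega3_quartic nz3C rt E0 E1 E2 E3; set z := w3 t => Ez.
apply: (@rad3_quadratic _ _ ((b3)%:~R * z - (3 * b2)%:~R) ((b1)%:~R * z - (3 * b0)%:~R)).
- apply: rad3B; last by apply: rad3_int; rewrite ?nz3C ?dvdz_mulr.
  by apply: rad3M; [exact: int3_int | exact: rad3_omega3C].
- apply: rad3B; last by apply: rad3_int; rewrite ?nz3C ?dvdz_mulr.
  by apply: rad3M; [exact: int3_int | exact: rad3_omega3C].
rewrite expr_div_n -exprM Ez !rmorphN !rmorphM /=; by field.
Qed.

Lemma rad3_omega2_sqr t : n1 = (2 * n2 + 1)%N -> rootC a b c t -> rad3 (w2 t ^+ 2 / 3).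
Proof.
move=> En rt.
have /v3geSP[b2 E2] := h2.
have /v3geSP[b1 E1] : v3ge (2 * n2 + 1) (A 1) by v3ge_auto.
have /v3geSP[b1' E1'] : v3ge (2 * n2 + 1 + 1) (A 1) by v3ge_auto.
have /v3geSP[b0 E0] : v3ge (2 * n2 + 1 + 1) (A 0) by v3ge_auto.
have s1 (x : int) n : x * 3 ^+ (n + 1) = x * 3 * 3 ^+ n by rewrite addn1 exprS mulrA.
rewrite s1 in E0; rewrite s1 in E1'.
rewrite (omega2_sqr nz3C rt E2 E0 E1' En).
have -> : ((b2 * 3)%:~R * w2 t + ((A 3)%:~R * 3 ^+ 1 * w3 t - (b0 * 3 * 3)%:~R -
    (b1' * 3 * 3)%:~R * (t + (3 * s)%:~R))) / 3 =
   b2%:~R * w2 t + (A 3)%:~R * w3 t - 3 * (b0%:~R + b1'%:~R * (t + (3 * s)%:~R)).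
  by rewrite !rmorphM /=; field.
apply: rad3B; last first.
  apply: rad3_3M; first exact: nz3C.
  apply: int3D; first exact: int3_int.
  by apply: int3M; [exact: int3_int | exact: int3_t3s rt].
apply: rad3D; apply: rad3M; try exact: int3_int.
  exact: rad3_omega2C.
exact: rad3_omega3C.
Qed.

(** Summing over the conjugates shows 3 | m_0, the symmetric function of degree
3 shows 3 | m_1.  What remains is multiplied by that one of omega_2 and
omega_3 whose square divided by 3 is in the radical, which isolates the
coefficient of the other one; then the roles are exchanged. *)
Lemma saturated_ramified : saturated3.
Proof.
move=> m0 m1 m2 m3 H.
have R01 t : rootC a b c t -> rad3 (m0%:~R + m1%:~R * t).
  move=> rt; have h := rad3_3C (H t rt).
  have -> : m0%:~R + m1%:~R * t = comb t m0 m1 m2 m3 - (m2%:~R * w2 t + m3%:~R * w3 t).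
    by rewrite /comb; ring.
  apply: rad3B => //; apply: rad3D; apply: rad3M; try exact: int3_int.
    exact: rad3_omega2C.
  exact: rad3_omega3C.
have d0 : (3 %| m0)%Z.
  have [t1 [t2 [t3 [t4 [[r1 r2 r3 r4] [E4 _ _ _]]]]]] := rootsC a b c.
  have : rad3 ((4 * m0)%:~R : algC).
    have -> : (4 * m0)%:~R = (m0%:~R + m1%:~R * t1) + (m0%:~R + m1%:~R * t2)
       + (m0%:~R + m1%:~R * t3) + (m0%:~R + m1%:~R * t4).
      by rewrite rmorphM /= E4; ring.
    by apply: rad3D (R01 _ r4); apply: rad3D (R01 _ r3); apply: rad3D; apply: R01.
  by move/rad3_intC; rewrite Euclid3.
have d1 : (3 %| m1)%Z.
  apply: (rad3_mul_root hb) => t rt.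
  have -> : m1%:~R * t = (m0%:~R + m1%:~R * t) - m0%:~R by ring.
  by apply: rad3B; [exact: R01 | exact: (rad3_int nz3C d0)].
have I23 t : rootC a b c t -> int3 ((m2%:~R * w2 t + m3%:~R * w3 t) / 3).
  move=> rt; have /dvdzP[q0 E0] := d0; have /dvdzP[q1 E1] := d1.
  have -> : (m2%:~R * w2 t + m3%:~R * w3 t) / 3 =
     comb t m0 m1 m2 m3 / 3 - (q0%:~R + q1%:~R * t).
    by rewrite /comb E0 E1 !rmorphM /=; field.
  apply: int3B; first exact: H.
  apply: int3D; first exact: int3_int.
  by apply: int3M; [exact: int3_int | exact: int3_root rt].
have [E|E] : n1 = (2 * n2)%N \/ n1 = (2 * n2 + 1)%N by lia.
- have d2 : (3 %| m2)%Z.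
    apply: rad3_mul_omega23 => t rt.
    have -> : m2%:~R * (w2 t * w3 t / 3) = (m2%:~R * w2 t + m3%:~R * w3 t) / 3 * w3 t
       - m3%:~R * (w3 t ^+ 2 / 3) by field.
    apply: rad3B; first by apply: rad3M; [exact: I23 | exact: rad3_omega3C].
    by apply: rad3M; [exact: int3_int | exact: rad3_omega3_sqr].
  have d3' : (3 %| m3)%Z.
    apply: rad3_mul_omega23 => t rt; have /dvdzP[q Eq] := d2.
    have -> : m3%:~R * (w2 t * w3 t / 3) = ((m2%:~R * w2 t + m3%:~R * w3 t) / 3
       - q%:~R * w2 t) * w2 t by rewrite Eq rmorphM /=; field.
    apply: rad3M; last exact: rad3_omega2C.
    apply: int3B; first exact: I23.
    by apply: int3M; [exact: int3_int | exact: rad3_int3 (rad3_omega2C rt)].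
  by [].
have d3' : (3 %| m3)%Z.
  apply: rad3_mul_omega23 => t rt.
  have -> : m3%:~R * (w2 t * w3 t / 3) = (m2%:~R * w2 t + m3%:~R * w3 t) / 3 * w2 t
     - m2%:~R * (w2 t ^+ 2 / 3) by field.
  apply: rad3B; first by apply: rad3M; [exact: I23 | exact: rad3_omega2C].
  by apply: rad3M; [exact: int3_int | exact: rad3_omega2_sqr].
have d2 : (3 %| m2)%Z.
  apply: rad3_mul_omega23 => t rt; have /dvdzP[q Eq] := d3'.
  have -> : m2%:~R * (w2 t * w3 t / 3) = ((m2%:~R * w2 t + m3%:~R * w3 t) / 3
     - q%:~R * w3 t) * w3 t by rewrite Eq rmorphM /=; field.
  apply: rad3M; last exact: rad3_omega3C.
  apply: int3B; first exact: I23.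
  by apply: int3M; [exact: int3_int | exact: rad3_int3 (rad3_omega3C rt)].
by [].
Qed.
End Ramified.

Section Discriminant.
Hypothesis int_w2 : forall t : algC, rootC a b c t -> int3 (w2 t).
Hypothesis int_w3 : forall t : algC, rootC a b c t -> int3 (w3 t).

(** Cramer's rule for the matrix of the conjugates of 1, t, omega_2, omega_3,
whose determinant has square disc(f)/3^(2 (n1 + n2)). *)
Lemma saturated_disc : ~~ v3ge (2 * (n1 + n2) + 2) (quartic_disc a b c) -> saturated3.
Proof.
move=> hd m0 m1 m2 m3 H.
have [t1 [t2 [t3 [t4 [[r1 r2 r3 r4] [E4 Ea Eb Ec]]]]]] := rootsC a b c.
pose G i j : option algC := nth None (nth [::] [::
  [:: Some 1; Some t1; Some (w2 t1); Some (w3 t1)];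
  [:: Some 1; Some t2; Some (w2 t2); Some (w3 t2)];
  [:: Some 1; Some t3; Some (w2 t3); Some (w3 t3)];
  [:: Some 1; Some t4; Some (w2 t4); Some (w3 t4)]] i) j.
pose M : 'M[algC]_4 := \matrix_(i < 4, j < 4) odflt 0 (G i j).
have detM : \det M ^+ 2 = (quartic_disc a b c)%:~R / 3 ^+ (2 * (n1 + n2)).
  have -> : \det M = (t2 - t1) * (t3 - t1) * (t4 - t1) * (t3 - t2) * (t4 - t2) * (t4 - t3)
      / 3 ^+ (n1 + n2).
    rewrite /M sparse_detE.
    lazy beta iota zeta delta [sparse_det skip foldr iota G nth odd negb Nat.leb].
    rewrite /omega2 /omega3 /quot2 /quot3 exprD.
    have p1 : (3 : algC) ^+ n1 != 0 by rewrite expf_neq0 ?nz3C.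
    have p2 : (3 : algC) ^+ n2 != 0 by rewrite expf_neq0 ?nz3C.
    move: (3 ^+ n1) (3 ^+ n2) p1 p2 => x y hx hy.
    move: (2 * s)%:~R (3 * s ^+ 2 + a)%:~R (s%:~R) (s ^+ 2 + a)%:~R (s ^+ 3 + a * s + b)%:~R.
    by move=> p q u v w; field; rewrite hx hy.
  rewrite expr_div_n -exprM mulnC; congr (_ / _).
  by rewrite quartic_disc_intr Ea Eb Ec E4; apply: quartic_disc_roots.
have hM i j : int3 (M i j).
  rewrite mxE; have R x : x \in [:: 1; t1; w2 t1; w3 t1; t2; w2 t2; w3 t2;
      t3; w2 t3; w3 t3; t4; w2 t4; w3 t4] -> int3 x.
    rewrite !inE; repeat (case/orP); move/eqP->;
      first [ exact: (int3_int _ 1) | by apply: int_w2 | by apply: int_w3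
            | by apply: int3_root; eassumption ].
  by case: i j => [[|[|[|[|i]]]] hi] [[|[|[|[|j]]]] hj] //=; apply: R; rewrite !inE eqxx ?orbT.
pose m (j : 'I_4) : int := nth 0 [:: m0; m1; m2; m3] j.
suff D j : (3 %| m j)%Z.
  by split; [exact: (D 0) | exact: (D 1) | exact: (D 2%:R) | exact: (D 3%:R)].
pose x : 'cV[algC]_4 := \col_i nth 0 [:: comb t1 m0 m1 m2 m3; comb t2 m0 m1 m2 m3;
   comb t3 m0 m1 m2 m3; comb t4 m0 m1 m2 m3] i.
have Mx : M *m (\col_j (m j)%:~R) = x.
  apply/colP => i; rewrite !mxE !big_ord_recl big_ord0 !mxE /m /comb /=.
  case: i => [[|[|[|[|i]]]] hi] //=; ring.
have hx i : int3 (x i 0 / 3).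
  by rewrite mxE; case: i => [[|[|[|[|i]]]] hi] //=; apply: H.
have : int3 (\det M * (m j)%:~R / 3).
  have -> : \det M * (m j)%:~R = (\adj M *m x) j 0.
    by rewrite -Mx mulmxA mul_adj_mx mul_scalar_mx !mxE.
  rewrite mxE mulr_suml; apply: int3_sum => i _; rewrite -mulrA.
  by apply: int3M; [exact: int3_adj | exact: hx].
move/(int3X 2); rewrite expr_div_n exprMn detM.
have -> : (quartic_disc a b c)%:~R / 3 ^+ (2 * (n1 + n2)) * (m j)%:~R ^+ 2 / 3 ^+ 2 =
   (m j ^+ 2 * quartic_disc a b c)%:~R / 3 ^+ (2 * (n1 + n2) + 2) :> algC.
  rewrite exprD rmorphM rmorphXn /=.
  have p1 : (3 : algC) ^+ (2 * (n1 + n2)) != 0 by rewrite expf_neq0 ?nz3C.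
  by move: (3 ^+ _) p1 => y hy; field.
move/int3_divC => h; apply: contraT => mj; move: hd.
by rewrite -(v3ge_gauss _ _ (_ : ~~ (3 %| m j ^+ 2)%Z)) ?h // Euclid3X.
Qed.
End Discriminant.
End Maximality.

(** * From conjugates in the algebraic numbers to the number field *)

Section Transfer.
Variables (a b c s : int) (n1 n2 : nat).
Notation f := (quartic a b c).
Notation w2 t := (omega2 a s t n2).
Notation w3 t := (omega3 a b s t n1).

Lemma irreducible_dvdp (F L : fieldType) (phi : {rmorphism F -> L}) (p q : {poly F}) (x : L) :
  irreducible_poly p -> root (map_poly phi p) x -> root (map_poly phi q) x -> p %| q.
Proof.
move=> [_ irr] rp rq; have [E|/irr] := eqVneq (size (gcdp p q)) 1%N.
  have cpq : coprimep (map_poly phi p) (map_poly phi q) by rewrite coprimep_map coprimep_def E.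
  by have := coprimep_root cpq rp; rewrite -rootE rq.
by rewrite dvdp_gcdl => /(_ isT) h; rewrite -(eqp_dvdl _ h) dvdp_gcdr.
Qed.

(** The polynomial of degree at most 3 whose value at t is
k0 + k1 t + k2 omega_2 + k3 omega_3. *)
Definition comb_poly (k0 k1 k2 k3 : rat) : {poly rat} :=
  let c3 := k3 / 3 ^+ n1 in let c2 := k2 / 3 ^+ n2 in
  Poly [:: k0 + (3 * s ^+ 2 + a)%:~R * c2 + (s ^+ 3 + a * s + b)%:~R * c3;
           k1 + (2 * s)%:~R * c2 + (s ^+ 2 + a)%:~R * c3; c2 + s%:~R * c3; c3].

Lemma comb_polyE (L : fieldType) (phi : {rmorphism rat -> L}) (k0 k1 k2 k3 : rat) (t : L) :
  (map_poly phi (comb_poly k0 k1 k2 k3)).[t] = phi k0 + phi k1 * t + phi k2 * w2 t + phi k3 * w3 t.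
Proof.
rewrite /comb_poly map_Poly horner_Poly /= /omega2 /omega3 /quot2 /quot3.
rewrite !(rmorph_nat phi, rmorph_int phi, fmorphV phi, rmorphXn phi, rmorphM phi, rmorphD phi).
by move: (3 ^+ n1)^-1 (3 ^+ n2)^-1 => x y; ring.
Qed.

Lemma rootCE (t : algC) : rootC a b c t -> root (map_poly ratr (map_poly intr f : {poly rat})) t.
Proof.
rewrite /rootC => rt; rewrite -map_poly_comp (eq_map_poly (fun n => ratr_int _ n)).
rewrite rootE quarticE map_Poly horner_Poly /=; apply/eqP.
by rewrite -[RHS]rt; ring.
Qed.

Section NumberField.
Variables (K : fieldExtType rat) (theta : K).
Hypothesis f_irr : irreducible_poly (map_poly intr f : {poly rat}).
Hypothesis f_theta : root (map_poly intr f) theta.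

Lemma map_in_alg_intr (p : {poly int}) :
  map_poly (in_alg K) (map_poly intr p) = map_poly intr p.
Proof.
by rewrite -map_poly_comp; apply: eq_map_poly => n /=; rewrite -in_algE rmorph_int.
Qed.

Lemma root_theta : theta ^+ 4 + a%:~R * theta ^+ 2 + b%:~R * theta + c%:~R = 0.
Proof.
have := f_theta; rewrite rootE quarticE map_Poly horner_Poly /= => /eqP H.
by rewrite -[RHS]H; ring.
Qed.

(** An integral equation satisfied by a polynomial expression in theta is
divisible by the irreducible polynomial f, hence satisfied at its other roots. *)
Lemma int3_conj (m0 m1 m2 m3 : int) : int3 (comb a b s n1 n2 theta m0 m1 m2 m3 / 3) ->
  forall t : algC, rootC a b c t -> int3 (comb a b s n1 n2 t m0 m1 m2 m3 / 3).
Proof.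
case=> m hm [p mp rp] t rt; exists m => //; exists p => //.
pose d : rat := m%:~R / 3.
pose Q := comb_poly (d * m0%:~R) (d * m1%:~R) (d * m2%:~R) (d * m3%:~R).
have QE (L : fieldType) (phi : {rmorphism rat -> L}) (u : L) :
   (map_poly phi Q).[u] = m%:~R * (comb a b s n1 n2 u m0 m1 m2 m3 / 3).
  rewrite comb_polyE /comb /d !(rmorph_nat phi, rmorph_int phi, fmorphV phi, rmorphM phi); ring.
have RE (L : fieldType) (phi : {rmorphism rat -> L}) (u : L) :
   (map_poly phi (map_poly intr p \Po Q)).[u] =
   (map_poly intr p).[m%:~R * (comb a b s n1 n2 u m0 m1 m2 m3 / 3)].
  rewrite map_comp_poly horner_comp QE -map_poly_comp; congr (_.[_]).
  by apply: eq_map_poly => n /=; rewrite rmorph_int.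
have fR : map_poly intr f %| map_poly intr p \Po Q.
  apply: (irreducible_dvdp (phi := in_alg K) f_irr (x := theta)).
    by rewrite map_in_alg_intr.
  by rewrite rootE RE.
rewrite rootE -(RE _ ratr) -rootE.
have /dvdpP[q ->] := fR.
by rewrite rmorphM rootM (rootCE rt) orbT.
Qed.

Hypothesis K_theta : <<1%VS; theta>>%VS = fullv.

Lemma size_quarticQ : size (map_poly intr f : {poly rat}) = 5.
Proof. by rewrite size_map_poly_id0 ?size_quartic // lead_coefE size_quartic polyseq_quartic. Qed.

Lemma comb_poly_span (x : K) : exists k0 k1 k2 k3 : rat,
  x = (map_poly (in_alg K) (comb_poly k0 k1 k2 k3)).[theta].
Proof.
have : x \in fullv by rewrite memvf.
rewrite -K_theta => /Fadjoin_polyP[p /polyOver1P[q ->] ->].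
pose fQ : {poly rat} := map_poly intr f; pose r := q %% fQ.
have sr : (size r <= 4)%N.
  by have := ltn_modp q fQ; rewrite -size_poly_eq0 size_quarticQ.
pose l2 := 3 ^+ n2 * (r`_2 - s%:~R * r`_3); pose l3 := 3 ^+ n1 * r`_3.
pose l1 := r`_1 - (2 * s)%:~R * (r`_2 - s%:~R * r`_3) - (s ^+ 2 + a)%:~R * r`_3.
pose l0 := r`_0 - (3 * s ^+ 2 + a)%:~R * (r`_2 - s%:~R * r`_3)
   - (s ^+ 3 + a * s + b)%:~R * r`_3.
exists l0, l1, l2, l3.
have -> : comb_poly l0 l1 l2 l3 = r.
  have h3 n : (3 : rat) ^+ n != 0 by rewrite expf_neq0.
  rewrite /comb_poly /l3 /l2 mulrAC divff // mul1r mulrAC divff // mul1r /l1 /l0.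
  apply/polyP => i; rewrite coef_Poly.
  case: i => [|[|[|[|i]]]] /=; try ring.
  by rewrite [RHS]nth_default ?(leq_trans sr) // nth_nil.
rewrite {1}(divp_eq q fQ) rmorphD rmorphM !hornerE.
have /eqP -> : (map_poly (in_alg K) fQ).[theta] == 0 by rewrite map_in_alg_intr.
by rewrite mulr0 add0r.
Qed.

Lemma comb_poly_inj (k0 k1 k2 k3 l0 l1 l2 l3 : rat) :
  (map_poly (in_alg K) (comb_poly k0 k1 k2 k3)).[theta] =
  (map_poly (in_alg K) (comb_poly l0 l1 l2 l3)).[theta] ->
  [/\ k0 = l0, k1 = l1, k2 = l2 & k3 = l3].
Proof.
move=> E; suff Ep : comb_poly k0 k1 k2 k3 = comb_poly l0 l1 l2 l3.
  have h n : (3 : rat) ^- n != 0 by rewrite invr_neq0 // expf_neq0.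
  have E3 : k3 = l3 by have := congr1 (coefp 3) Ep; rewrite /coefp /= !coef_Poly /= => /(mulIf (h _)).
  have E2 : k2 = l2.
    have := congr1 (coefp 2) Ep; rewrite /coefp /= !coef_Poly /= E3.
    by move=> /addIr/(mulIf (h _)).
  have E1 : k1 = l1 by have := congr1 (coefp 1) Ep; rewrite /coefp /= !coef_Poly /= E3 E2 => /addIr/addIr.
  by have := congr1 (coefp 0) Ep; rewrite /coefp /= !coef_Poly /= E3 E2 => /addIr/addIr.
apply/eqP; rewrite -subr_eq0; set R := _ - _.
have fR : map_poly intr f %| R.
  apply: (irreducible_dvdp (phi := in_alg K) f_irr (x := theta)); first by rewrite map_in_alg_intr.
  by rewrite rootE rmorphB hornerD hornerN E subrr.
apply: contraTT fR => RN; apply/negP => /(dvdp_leq RN).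
rewrite size_quarticQ leqNgt ltnS (leq_trans (size_polyD _ _)) // size_polyN geq_max.
by rewrite !(leq_trans (size_Poly _)).
Qed.

Lemma Z3_denominator (q : rat) (m d : int) : ~~ (3 %| d)%Z -> q * d%:~R = m%:~R -> q \in Z_3.
Proof.
move=> hd Eq; rewrite unfold_in; apply/negP => h3.
have E : numq q * d = m * denq q.
  apply: (@intr_inj rat); rewrite !rmorphM /= -Eq mulrAC; congr (_ * _).
  by rewrite numqE.
have : (3 %| numq q * d)%Z by rewrite E dvdz_mull.
rewrite Euclid3 (negPf hd) orbF => hn.
have := coprime_num_den q; rewrite /coprime => /eqP g1.
have : (3 %| gcdn `|numq q| `|denq q|)%N by rewrite dvdn_gcd; apply/andP.
by rewrite g1.
Qed.

Hypothesis int_w2 : int3 (w2 theta).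
Hypothesis int_w3 : int3 (w3 theta).
Hypothesis sat : saturated3 a b c s n1 n2.

Lemma saturatedX N (m0 m1 m2 m3 : int) :
  int3 (comb a b s n1 n2 theta m0 m1 m2 m3 / 3 ^+ N) ->
  [/\ v3ge N m0, v3ge N m1, v3ge N m2 & v3ge N m3].
Proof.
have nz3 : (3 : K) != 0.
  by rewrite -[3%:R]/(3%:R) -(rmorph_nat (in_alg K)) fmorph_eq0.
elim: N m0 m1 m2 m3 => [|N IHN] m0 m1 m2 m3 h; first by split; apply: v3ge_0.
have h' : int3 (comb a b s n1 n2 theta m0 m1 m2 m3 / 3).
  have -> : comb a b s n1 n2 theta m0 m1 m2 m3 / 3 =
     3 ^+ N * (comb a b s n1 n2 theta m0 m1 m2 m3 / 3 ^+ N.+1).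
    rewrite exprS; have h3 : (3 : K) ^+ N != 0 by rewrite expf_neq0.
    by move: (3 ^+ N) h3 (comb _ _ _ _ _ _ _ _ _ _) => y hy z; field; rewrite hy nz3.
  by apply: int3M => //; apply: int3X; apply: int3_nat.
have [/dvdzP[q0 E0] /dvdzP[q1 E1] /dvdzP[q2 E2] /dvdzP[q3 E3]] := sat (int3_conj h').
have /IHN[d0 d1 d2 d3'] : int3 (comb a b s n1 n2 theta q0 q1 q2 q3 / 3 ^+ N).
  suff -> : comb a b s n1 n2 theta q0 q1 q2 q3 / 3 ^+ N =
    comb a b s n1 n2 theta m0 m1 m2 m3 / 3 ^+ N.+1 by [].
  rewrite /comb E0 E1 E2 E3 !rmorphM exprS /=.
  have h3 : (3 : K) ^+ N != 0 by rewrite expf_neq0.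
  by move: (3 ^+ N) h3 (w2 _) (w3 _) => y hy u v; field; rewrite hy nz3.
by rewrite E0 E1 E2 E3 !(mulrC _ 3) -[3]expr1 -addn1 addnC !v3ge_split.
Qed.
Lemma common_denominator (k0 k1 k2 k3 : rat) : exists D m0 m1 m2 m3 : int,
  D != 0 /\ [/\ k0 * D%:~R = m0%:~R, k1 * D%:~R = m1%:~R, k2 * D%:~R = m2%:~R & k3 * D%:~R = m3%:~R].
Proof.
exists (denq k0 * denq k1 * denq k2 * denq k3).
exists (numq k0 * (denq k1 * denq k2 * denq k3)), (numq k1 * (denq k0 * denq k2 * denq k3)).
exists (numq k2 * (denq k0 * denq k1 * denq k3)), (numq k3 * (denq k0 * denq k1 * denq k2)).
split; first by rewrite !mulf_neq0 // denq_neq0.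
by split; rewrite !rmorphM /= numqE; ring.
Qed.

(** Write the common denominator as 3^N d with d prime to 3; saturation shows
that 3^N divides the numerators. *)
Lemma integral3_coordinates (x : K) (k0 k1 k2 k3 : rat) : int3 x ->
  x = (map_poly (in_alg K) (comb_poly k0 k1 k2 k3)).[theta] ->
  [/\ k0 \in Z_3, k1 \in Z_3, k2 \in Z_3 & k3 \in Z_3].
Proof.
move=> hx Ex; have [D [m0 [m1 [m2 [m3 [DN [E0 E1 E2 E3]]]]]]] := common_denominator k0 k1 k2 k3.
have [d ED hd] := v3ge_exact DN; set N := logn _ _ in ED.
have nzK : (3 : K) ^+ N != 0.
  by rewrite expf_neq0 // -(rmorph_nat (in_alg K)) fmorph_eq0.
have : int3 (comb a b s n1 n2 theta m0 m1 m2 m3 / 3 ^+ N).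
  suff -> : comb a b s n1 n2 theta m0 m1 m2 m3 / 3 ^+ N = d%:~R * x.
    by apply: int3M => //; apply: int3_int.
  rewrite Ex comb_polyE /comb -!(rmorph_int (in_alg K)) -E0 -E1 -E2 -E3 ED.
  rewrite !(rmorph_int (in_alg K), rmorphM, rmorphXn, rmorph_nat) /=.
  move: (3 ^+ N) nzK (w2 _) (w3 _) => y hy u v.
  by field.
move/saturatedX => [/dvdzP[q0 F0] /dvdzP[q1 F1] /dvdzP[q2 F2] /dvdzP[q3 F3]].
have Z k m q : k * D%:~R = m%:~R -> m = q * 3 ^+ N -> k \in Z_3.
  move=> Ek Em; apply: (@Z3_denominator k q d hd).
  have h3 : ((3 ^+ N : int)%:~R : rat) != 0 by rewrite intr_eq0 expf_neq0.
  apply: (mulfI h3); rewrite mulrCA -rmorphM /= -ED Ek Em rmorphM /=; ring.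
by split; [exact: Z E0 F0 | exact: Z E1 F1 | exact: Z E2 F2 | exact: Z E3 F3].
Qed.

Lemma sum_tnth4 (k : {ffun 'I_4 -> rat}) :
  \sum_(i < 4) k i *: tnth [tuple 1; theta; w2 theta; w3 theta] i =
  (map_poly (in_alg K) (comb_poly (k ord0) (k (lift ord0 ord0))
     (k (lift ord0 (lift ord0 ord0))) (k (lift ord0 (lift ord0 (lift ord0 ord0)))))).[theta].
Proof.
rewrite comb_polyE !big_ord_recl big_ord0 addr0 !(tnth_nth 0) /= !mulr_algl.
by rewrite !addrA.
Qed.

Lemma integral_basis3_saturated :
  integral_basis3 [tuple 1; theta; w2 theta; w3 theta].
Proof.
split.
  case=> [[|[|[|[|i]]]] hi] //; rewrite (tnth_nth 0) /=.
  - exact: (int3_int K 1).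
  exact: (int3_root root_theta).
move=> x hx; have [k0 [k1 [k2 [k3 Ex]]]] := comb_poly_span x.
have [z0 z1 z2 z3] := integral3_coordinates hx Ex.
exists [ffun i : 'I_4 => nth 0 [:: k0; k1; k2; k3] i]; split.
  split; last by rewrite sum_tnth4 !ffunE /= Ex.
  by move=> i; rewrite ffunE; case: i => [[|[|[|[|i]]]] hi].
move=> k [_]; rewrite Ex sum_tnth4 => /comb_poly_inj[e0 e1 e2 e3].
apply/ffunP => i; rewrite ffunE; case: i => [[|[|[|[|i]]]] hi] //=.
- by rewrite e0; congr (k _); apply: val_inj.
- by rewrite e1; congr (k _); apply: val_inj.
- by rewrite e2; congr (k _); apply: val_inj.
by rewrite e3; congr (k _); apply: val_inj.
Qed.
End NumberField.
End Transfer.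

(** * Integral bases from the shape of the polygon *)

Section V3.

Lemma v3_eq (n : int) (k : nat) : v3 n = k%:R%:E <-> n != 0 /\ logn 3 `|n| = k.
Proof.
rewrite /v3; have [->|nN] := eqVneq n 0; first by split=> // -[].
by split => [[/eqP]|[_ ->]] //; rewrite eqr_nat => /eqP.
Qed.

Lemma v3_gt (n : int) (k : nat) : (k%:R%:E < v3 n)%E <-> v3ge (k + 1) n.
Proof.
rewrite /v3; have [->|nN] := eqVneq n 0; first by rewrite /v3ge dvdz0 ltry.
by rewrite lte_fin ltr_nat v3ge_logn // addn1.
Qed.

Lemma v3_gt_div (n : int) (k : nat) : ((k%:R / 6%:R)%:E < v3 n)%E <-> (n != 0 -> (k < 6 * logn 3 `|n|)%N).
Proof.
rewrite /v3; have [->|nN] := eqVneq n 0; first by rewrite ltry; split.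
rewrite lte_fin ltr_pdivrMr // -natrM ltr_nat mulnC; by split => // /(_ isT).
Qed.

Lemma v3_lt_mul (n : int) (k : nat) :
  ((2 * k)%:R%:E < 3%:R%:E * v3 n)%E <-> (n != 0 -> (2 * k < 3 * logn 3 `|n|)%N).
Proof.
rewrite /v3; have [->|nN] := eqVneq n 0; first by rewrite gt0_muley ?lte_fin // ltry; split.
by rewrite -EFinM lte_fin -natrM ltr_nat; split => // /(_ isT).
Qed.

End V3.

Section Bases.
Variables (a b c s : int).
Notation f := (quartic a b c).
Notation A := (taylor_coef f s).
Variables (K : fieldExtType rat) (theta : K).
Hypothesis f_irr : irreducible_poly (map_poly intr f : {poly rat}).
Hypothesis f_theta : root (map_poly intr f) theta.
Hypothesis K_theta : <<1%VS; theta>>%VS = fullv.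
Notation basis n1 n2 :=
  (integral_basis3 [tuple 1; theta; omega2 a s theta n2; omega3 a b s theta n1]).

Lemma basis_disc n1 n2 : v3ge n1 (A 1) -> v3ge (2 * n1) (A 2 * A 0) ->
    v3ge (3 * n1) (A 3 * A 0 ^+ 2) -> v3ge (4 * n1) (A 0 ^+ 3) ->
    v3ge n2 (A 2) -> v3ge (2 * n2) (A 0) -> v3ge (2 * n2) (A 1) -> (2 * n2 <= n1)%N ->
    ~~ v3ge (2 * (n1 + n2) + 2) (quartic_disc a b c) ->
  basis n1 n2.
Proof.
move=> h1 h2 h3 h4 h5 h6 h7 le hd.
have nz3K : (3 : K) != 0 by rewrite -(rmorph_nat (in_alg K)) fmorph_eq0.
have i3 (F : fieldType) (nz : (3 : F) != 0) t rt := @int3_omega3 F a b c s t nz rt n1 h1 h2 h3 h4.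
have i2 (F : fieldType) (nz : (3 : F) != 0) t rt :=
  @int3_omega2 F a b c s t nz rt n1 n2 h5 h6 h7 le (i3 F nz t rt).
apply: integral_basis3_saturated f_irr f_theta K_theta _ _ _.
- exact: i2 nz3K _ (root_theta f_theta).
- exact: i3 nz3K _ (root_theta f_theta).
by apply: saturated_disc hd => t rt; [exact: i2 nz3C _ rt | exact: i3 nz3C _ rt].
Qed.

Lemma taylor_disc_tame (A0 A1 A2 A3 : int) n e0 e2 : (0 < n)%N -> (3 * n <= 2 * e0)%N ->
    (n < 2 * e2)%N -> v3ge e0 A0 -> v3ge n A1 -> v3ge e2 A2 ->
  v3ge (3 * n + 1) (taylor_disc A0 A1 A2 A3 + 4 * A3 ^+ 3 * A1 ^+ 3).
Proof.
move=> n0 le0 le2 h0 h1 h2.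
have -> : taylor_disc A0 A1 A2 A3 + 4 * A3 ^+ 3 * A1 ^+ 3 =
  256 * A0 ^+ 3 - 192 * A3 * A1 * A0 ^+ 2 - 128 * A2 ^+ 2 * A0 ^+ 2
  + 144 * A2 * A1 ^+ 2 * A0 - 27 * A1 ^+ 4 + 144 * A3 ^+ 2 * A2 * A0 ^+ 2
  - 6 * A3 ^+ 2 * A1 ^+ 2 * A0 - 80 * A3 * A2 ^+ 2 * A1 * A0
  + 18 * A3 * A2 * A1 ^+ 3 + 16 * A2 ^+ 4 * A0 - 4 * A2 ^+ 3 * A1 ^+ 2
  - 27 * A3 ^+ 4 * A0 ^+ 2 + 18 * A3 ^+ 3 * A2 * A1 * A0
  - 4 * A3 ^+ 2 * A2 ^+ 3 * A0 + A3 ^+ 2 * A2 ^+ 2 * A1 ^+ 2.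
  by rewrite /taylor_disc; ring.
by v3ge_auto.
Qed.

(** The side ending at (3, 0) starts at (1, n).  The main term of the
discriminant is -4 A_3^3 A_1^3, so it has valuation 3n. *)
Lemma basis_tame n e0 e2 : ~~ (3 %| s)%Z -> (0 < n)%N -> A 1 != 0 -> logn 3 `|A 1| = n ->
    v3ge e0 (A 0) -> v3ge e2 (A 2) -> (3 * n <= 2 * e0)%N -> (n < 2 * e2)%N ->
  basis n (n %/ 2).
Proof.
move=> hs n0 A1N o1 h0 h2 le0 le2.
have h1 : v3ge n (A 1) by rewrite v3ge_logn // o1.
apply: basis_disc; try v3ge_auto; first by lia.
apply/negP => /v3ge_le/(_ (_ : (3 * n + 1 <= _)%N)) h.
have {h} : v3ge (3 * n + 1) (quartic_disc a b c) by apply: h; lia.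
rewrite (disc_taylor a b c s) => h.
have := taylor_disc_tame (A 3) n0 le0 le2 h0 h1 h2.
rewrite -[4 * _ * _]opprK => /(v3ge_subl h); rewrite -mulNr -mulNr.
have [u Eu hu] := v3ge_exact A1N; rewrite o1 in Eu.
have -> : -4 * A 3 ^+ 3 * A 1 ^+ 3 = 3 ^+ (3 * n) * (-4 * A 3 ^+ 3 * u ^+ 3).
  by rewrite Eu (mulnC 3) exprM; move: (3 ^+ n) (A 3) => x y; ring.
rewrite v3ge_split /v3ge expr1 !(Euclid3X, Euclid3) /= (negPf hu).
by have := @taylor_coef3_unit a b c s hs => /negPf->.
Qed.

Lemma basis_ramified m : ~~ (3 %| b)%Z -> A 0 != 0 -> logn 3 `|A 0| = m -> ~~ (3 %| m)%N ->
    v3ge (2 * m %/ 3 + 1) (A 1) -> v3ge (m %/ 3 + 1) (A 2) ->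
  basis (2 * m %/ 3) (m %/ 3).
Proof.
move=> hb A0N o0 m3 h1 h2; set n1 := (2 * m %/ 3)%N in h1 *; set n2 := (m %/ 3)%N in h2 *.
have Em : m = (n1 + n2 + 1)%N by rewrite /n1 /n2; lia.
have n12 : (2 * n2 <= n1 <= 2 * n2 + 1)%N by rewrite /n1 /n2; lia.
have [u Eu hu] := v3ge_exact A0N; rewrite o0 Em mulrC in Eu.
have h0 : v3ge (n1 + n2 + 1) (A 0) by rewrite Eu /v3ge dvdz_mull.
have nz3K : (3 : K) != 0 by rewrite -(rmorph_nat (in_alg K)) fmorph_eq0.
have rt := root_theta f_theta.
clearbody n1 n2; clear Em m3 o0.
have i3 : int3 (omega3 a b s theta n1) by apply: (int3_omega3 nz3K rt); v3ge_auto.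
apply: integral_basis3_saturated f_irr f_theta K_theta _ _ _ => //.
  by apply: (int3_omega2 nz3K rt _ _ _ _ i3); try v3ge_auto; lia.
exact: (saturated_ramified hb Eu hu h1 h2 n12).
Qed.

Lemma basis_steep k n (D : nat) : steep a b c k n s -> (4 * k + n = D)%N ->
    quartic_disc a b c != 0 -> logn 3 `|quartic_disc a b c| = D ->
  basis (D %/ 2 - k) k.
Proof.
move=> [_ [u Eu hu] kn h0 h1] ED dN oD.
have h2 : v3ge k (A 2) by rewrite Eu /v3ge dvdz_mulr.
have -> : (D %/ 2 - k = k + n %/ 2)%N by lia.
apply: basis_disc; try v3ge_auto; first by lia.
by rewrite v3ge_logn // oD; lia.
Qed.
End Bases.

(** * The starting integer and its first correction *)

Section Approximation.
Variables (a b c s0 : int) (D : nat).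
Notation f := (quartic a b c).
Notation A := (taylor_coef f).
Notation o := (ordinate f).
Hypothesis A2_large : A s0 2 != 0 -> (D < 6 * o s0 2)%N.

Lemma A2_large_disc j : (6 * j <= D)%N -> v3ge (j + 1) (A s0 2).
Proof.
have [->|h] := eqVneq (A s0 2) 0; first by rewrite /v3ge dvdz0.
by move=> le; rewrite v3ge_logn // -/(o s0 2); have := A2_large h; lia.
Qed.

Hypothesis disc_neq0 : quartic_disc a b c != 0.
Hypothesis disc_ord : logn 3 `|quartic_disc a b c| = D.

(** Otherwise 3^(6 v), with v = v_3(A_2) at most j, would divide the
discriminant, by weights. *)
Lemma A2_large_weight j : v3ge (2 * j) (A s0 1) -> v3ge (3 * j) (A s0 0) -> v3ge (j + 1) (A s0 2).
Proof.
move=> h1 h0; apply: contraT => h2.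
have h : A s0 2 != 0 by apply: contraNneq h2 => ->; rewrite /v3ge dvdz0.
have le : (o s0 2 <= j)%N by move: h2; rewrite v3ge_logn // -/(o s0 2); lia.
have : v3ge (6 * o s0 2) (quartic_disc a b c).
  rewrite (disc_taylor _ _ _ s0); apply: taylor_disc_weight.
  - by apply: v3ge_le h0 _; lia.
  - by apply: v3ge_le h1 _; lia.
  by rewrite v3ge_logn.
by rewrite v3ge_logn // disc_ord; have := A2_large h; lia.
Qed.

End Approximation.

Section Correction.
Variables (a b c : int).
Notation f := (quartic a b c).
Notation A := (taylor_coef f).
Notation o := (ordinate f).

(** The residual polynomial at s0 is c_3 y^3 + c_0 = sigma + s0 y^3 modulo 3,
and y^3 = y for the chosen root. *)
Lemma first_correction s0 s1 y sigma k : (0 < k)%N -> ~~ (3 %| s0)%Z ->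
    A s0 0 = sigma * 3 ^+ (3 * k) -> v3ge (2 * k + 1) (A s0 1) -> v3ge (k + 1) (A s0 2) ->
    y = 1 \/ y = -1 -> (3 %| sigma + s0 * y)%Z -> s1 = s0 + y * 3 ^+ k ->
  [/\ ~~ (3 %| s1)%Z, v3ge (3 * k + 1) (A s1 0), v3ge (2 * k + 1) (A s1 1)
    & v3ge (k + 1) (A s1 2)].
Proof.
move=> k0 hs E0 h1 h2 y_unit y_root ->.
have hh : v3ge k (y * 3 ^+ k) by rewrite /v3ge dvdz_mull.
split.
- by rewrite rpredDr // dvdz_mull // Euclid3X k0.
- rewrite taylor_coef0 taylor_horner.
  have -> : A s0 0 + A s0 1 * (y * 3 ^+ k) + A s0 2 * (y * 3 ^+ k) ^+ 2 +
      A s0 3 * (y * 3 ^+ k) ^+ 3 + (y * 3 ^+ k) ^+ 4 =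
    3 ^+ (3 * k) * (sigma + s0 * y + 3 * (s0 * y)) + A s0 1 * (y * 3 ^+ k) +
      A s0 2 * (y * 3 ^+ k) ^+ 2 + (y * 3 ^+ k) ^+ 4.
    rewrite E0 taylor_coef3 (mulnC 3) exprM; move: (A s0 1) (A s0 2) (3 ^+ k) => A1 A2 x.
    by case: y_unit => ->; ring.
  move: hh; move: (y * 3 ^+ k) => h hk.
  apply: v3geD; last by v3ge_auto.
  do 2! (apply: v3geD; last by v3ge_auto).
  by rewrite v3ge_split /v3ge expr1 rpredD // dvdz_mulr.
- by rewrite taylor_coef1 taylor_deriv; move: hh; move: (y * 3 ^+ k) => h hk; v3ge_auto.
by rewrite taylor_second; move: hh; move: (y * 3 ^+ k) => h hk; v3ge_auto.
Qed.

(** The correction adds 3 A_3 y 3^k, of valuation exactly k + 1, to A_2. *)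
Lemma correction_ord2 s0 s1 y k : (0 < k)%N -> ~~ (3 %| s0)%Z -> v3ge (k + 2) (A s0 2) ->
    y = 1 \/ y = -1 -> s1 = s0 + y * 3 ^+ k ->
  exists2 u, A s1 2 = 3 ^+ (k + 1) * u & ~~ (3 %| u)%Z.
Proof.
move=> k0 hs /dvdzP[q Eq] y_unit ->.
have k1 : 3 ^+ k = 3 * 3 ^+ (k - 1) :> int by rewrite -exprS; congr (3 ^+ _); lia.
exists (3 * q + 4 * s0 * y + 3 * (2 * y ^+ 2 * 3 ^+ (k - 1))).
  by rewrite taylor_second Eq taylor_coef3 !addnS !addn0 !exprS k1; move: (3 ^+ (k - 1)) => x; ring.
rewrite rpredDr; last exact: dvdz_mulr.
rewrite rpredDl; last exact: dvdz_mulr.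
by rewrite !Euclid3 (negPf hs) /=; case: y_unit => ->.
Qed.

Lemma regular_ramified s m : ~~ (3 %| s)%Z -> A s 0 != 0 -> o s 0 = m -> ~~ (3 %| m)%N ->
    v3ge (2 * m %/ 3 + 1) (A s 1) -> v3ge (m %/ 3 + 1) (A s 2) ->
  regular f s.
Proof.
move=> hs A0N o0 m3 h1 h2; apply: contraT => /(irregular_cases hs)[mu mu0].
case=> [[_ o0' _ _]|[A1N o1 h0 _]|[_ A2N o0' lt _]].
- by move: m3; rewrite -o0 o0' dvdn_mulr.
- by move: h1 h0; rewrite !v3ge_logn // -!/(o s _); nlia.
by move: h2; rewrite !v3ge_logn // -!/(o s _); nlia.
Qed.

Lemma regular_tame s n e0 e2 : ~~ (3 %| s)%Z -> A s 1 != 0 -> o s 1 = n -> odd n ->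
    v3ge e0 (A s 0) -> v3ge e2 (A s 2) -> (3 * n <= 2 * e0)%N -> (n < 2 * e2)%N ->
  regular f s.
Proof.
move=> hs A1N o1 n_odd h0 h2 le0 le2; apply: contraT => /(irregular_cases hs)[mu mu0].
case=> [[A0N o0 h1 _]|[_ o1' _ _]|[A0N A2N o0 lt h1]].
- by move: h1 h0; rewrite !v3ge_logn // -!/(o s _); nlia.
- by nlia.
by move: h2 h1; rewrite !v3ge_logn // -!/(o s _); nlia.
Qed.
End Correction.

(** * The theorem *)

Lemma cube_mod3 (x : int) : (3 %| x ^+ 3 - x)%Z.
Proof. by rewrite -intr_F3_eq0 rmorphB rmorphXn /= cube_F3 subrr. Qed.

Lemma sign_root (b q s x : int) : ~~ (3 %| b)%Z -> ~~ (3 %| x)%Z -> s = - b + 3 * q ->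
  (3 %| x + s * (if (x == b %[mod 3])%Z then 1 else -1))%Z.
Proof. by move=> hb hx ->; case: ifP; lia. Qed.

Lemma irreducible_no_root (f : {poly int}) (s : int) :
  irreducible_poly (map_poly intr f : {poly rat}) -> (2 < size f)%N -> f.[s] != 0.
Proof.
move=> [_ irr] sf; apply/eqP => r0.
have : ('X - (s%:~R)%:P : {poly rat}) %| map_poly intr f.
  by rewrite dvdp_XsubCl rootE horner_map /= r0.
move/irr; rewrite size_XsubC => /(_ isT)/eqp_size.
rewrite size_XsubC size_map_poly_id0 => [E|]; first by rewrite -E in sf.
by rewrite intr_eq0 lead_coef_eq0 -size_poly_gt0; apply: leq_trans sf.
Qed.

Section Main.
Variables (a b c : int) (K : fieldExtType rat) (theta : K).
Variables (Delta u0 : nat) (s0 sigma0 y s1 : int).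
Notation f := (quartic a b c).
Notation A := (taylor_coef f).
Notation o := (ordinate f).
Notation u1 := (v3 f^`().[s0]).

Notation basis s n1 n2 :=
  (integral_basis3 [tuple 1; theta; omega2 a s theta n2; omega3 a b s theta n1]).
Notation below_u1 := ((2 * u0)%:R%:E < 3%:R%:E * u1)%E.

Lemma below_u1P : below_u1 <-> (A s0 1 != 0 -> (2 * u0 < 3 * o s0 1)%N).
Proof. by rewrite -taylor_coef1; apply: v3_lt_mul. Qed.

Lemma below_u1_dvd3 : below_u1 /\ (3 %| u0)%N <->
  exists2 k, u0 = (3 * k)%N & v3ge (2 * k + 1) (A s0 1).
Proof.
split=> [[/below_u1P lt /dvdnP[k Ek]]|[k Ek h1]].
  exists k; first by rewrite Ek mulnC.
  have [->|A1N] := eqVneq (A s0 1) 0; first by rewrite /v3ge dvdz0.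
  by rewrite v3ge_logn //; have := lt A1N; rewrite /ordinate; nlia.
split; last by rewrite Ek dvdn_mulr.
by apply/below_u1P => A1N; move: h1; rewrite v3ge_logn // /ordinate; nlia.
Qed.

Hypothesis f_irr : irreducible_poly (map_poly intr f : {poly rat}).
Hypothesis f_theta : root (map_poly intr f) theta.
Hypothesis K_theta : <<1%VS; theta>>%VS = fullv.
Hypothesis disc_neq0 : quartic_disc a b c != 0.
Hypothesis disc_ord : logn 3 `|quartic_disc a b c| = Delta.
Hypothesis hb : ~~ (3 %| b)%Z.
Hypothesis hs : ~~ (3 %| s0)%Z.
Hypothesis A2_large : A s0 2 != 0 -> (Delta < 6 * o s0 2)%N.
Hypothesis A0_neq0 : A s0 0 != 0.
Hypothesis A0_ord : o s0 0 = u0.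
Hypothesis A0_dvd : v3ge 1 (A s0 0).
Hypothesis A1_dvd : v3ge 1 (A s0 1).

Let v0 s k : v3 f.[s] = k%:R%:E <-> A s 0 != 0 /\ o s 0 = k.
Proof. by rewrite -taylor_coef0; apply: v3_eq. Qed.
Let v1 s k : v3 f^`().[s] = k%:R%:E <-> A s 1 != 0 /\ o s 1 = k.
Proof. by rewrite -taylor_coef1; apply: v3_eq. Qed.
Let g0 s k : (k%:R%:E < v3 f.[s])%E <-> v3ge (k + 1) (A s 0).
Proof. by rewrite -taylor_coef0; apply: v3_gt. Qed.
Let g1 s k : (k%:R%:E < v3 f^`().[s])%E <-> v3ge (k + 1) (A s 1).
Proof. by rewrite -taylor_coef1; apply: v3_gt. Qed.

Let U j : v3ge (2 * j) (A s0 1) -> v3ge (3 * j) (A s0 0) -> v3ge (j + 1) (A s0 2).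
Proof. exact: (A2_large_weight A2_large disc_neq0 disc_ord). Qed.

Let u0_gt0 : (0 < u0)%N.
Proof. by rewrite -A0_ord /ordinate -v3ge_logn. Qed.

Lemma irregular_s0P :
  irregular f s0 <-> exists2 k, u0 = (3 * k)%N & v3ge (2 * k + 1) (A s0 1).
Proof.
have o0_gt0 : (0 < o s0 0)%N by rewrite A0_ord.
by have := irregular_triple hs A0_neq0 o0_gt0 U; rewrite A0_ord.
Qed.

Section RegularStart.
Hypothesis reg : regular f s0.

Let not_c : ~ (below_u1 /\ (3 %| u0)%N).
Proof. by move/below_u1_dvd3/irregular_s0P; rewrite /irregular reg. Qed.

Lemma exponents_regular : exists n1 n2, exponents f Delta u0 u1 s1 n1 n2.
Proof.
have [h|h] := boolP below_u1.
  exists (2 * u0 %/ 3)%N, (u0 %/ 3)%N; apply: exponents_b => //.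
  by apply/negP => h3; apply: not_c.
have A1N : A s0 1 != 0.
  by apply: contraNneq h => A1E0; apply/below_u1P; rewrite A1E0.
have u1E : u1 = (o s0 1)%:R%:E by apply/v1.
exists (o s0 1), (o s0 1 %/ 2)%N.
by apply: exponents_a => //; rewrite leNgt.
Qed.

Lemma basis_regular n1 n2 : exponents f Delta u0 u1 s1 n1 n2 -> basis s0 n1 n2.
Proof.
case=> {n1 n2}; try by [move=> *; case: not_c].
  move=> n /v1[A1N o1]; rewrite ((v1 _ _).2 (conj A1N o1)) -EFinM lee_fin -natrM ler_nat => le.
  have n_gt0 : (0 < n)%N by rewrite -o1 /ordinate -v3ge_logn.
  have h2 : v3ge (n %/ 2 + 1) (A s0 2).
    by apply: U; rewrite v3ge_logn // -/(o s0 _); nlia.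
  apply: (basis_tame f_irr f_theta K_theta hs n_gt0 A1N o1 (e0 := u0) _ h2); try nlia.
  by rewrite v3ge_logn // -A0_ord.
move=> /below_u1P lt n3; apply: (basis_ramified f_irr f_theta K_theta) => //.
  have [->|A1N] := eqVneq (A s0 1) 0; first by rewrite /v3ge dvdz0.
  by rewrite v3ge_logn // -/(o s0 _); have := lt A1N; nlia.
apply: U; last by rewrite v3ge_logn // -/(o s0 _); nlia.
have [->|A1N] := eqVneq (A s0 1) 0; first by rewrite /v3ge dvdz0.
by rewrite v3ge_logn // -/(o s0 _); have := lt A1N; nlia.
Qed.
End RegularStart.

Section IrregularStart.
Hypothesis sigma_def : A s0 0 = sigma0 * 3 ^+ u0.
Hypothesis y_unit : y = 1 \/ y = -1.
Hypothesis y_root : (3 %| sigma0 + s0 * y)%Z.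
Hypothesis s1_def : s1 = s0 + y * 3 ^+ (u0 %/ 3).
Variable k : nat.
Hypothesis u0E : u0 = (3 * k)%N.
Hypothesis A1_dvd_k : v3ge (2 * k + 1) (A s0 1).

Let k_gt0 : (0 < k)%N. Proof. by nlia. Qed.
Let u0_div : (u0 %/ 3 = k)%N. Proof. by nlia. Qed.
Let u0_div2 : (2 * u0 %/ 3 = 2 * k)%N. Proof. by nlia. Qed.

Let cond : below_u1 /\ (3 %| u0)%N.
Proof. by apply/below_u1_dvd3; exists k. Qed.

Let s1E : s1 = s0 + y * 3 ^+ k. Proof. by rewrite s1_def u0_div. Qed.

Let s1_facts : [/\ ~~ (3 %| s1)%Z, v3ge (3 * k + 1) (A s1 0),
  v3ge (2 * k + 1) (A s1 1) & v3ge (k + 1) (A s1 2)].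
Proof.
have E0 : A s0 0 = sigma0 * 3 ^+ (3 * k) by rewrite sigma_def u0E.
apply: (first_correction k_gt0 hs E0 A1_dvd_k _ y_unit y_root s1E).
by apply: U; [apply: v3ge_le A1_dvd_k _; nlia | rewrite E0 /v3ge dvdz_mull].
Qed.

Let A0_s1_neq0 : A s1 0 != 0.
Proof. by rewrite taylor_coef0; apply: irreducible_no_root f_irr _; rewrite size_quartic. Qed.

(** Here 6 (k + 1) <= Delta, so that A_2 at s0 is divisible by 3^(k+2) and its
valuation at s1 is governed by the correction alone. *)
Lemma steep_s1 : v3ge (3 * k + 3) (A s1 0) -> v3ge (2 * k + 2) (A s1 1) ->
  steep a b c (k + 1) (2 * (k + 1)) s1 /\ (6 * (k + 1) <= Delta)%N.
Proof.
have [hs' _ _ B2] := s1_facts; move=> h0 h1.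
have le : (6 * (k + 1) <= Delta)%N.
  rewrite -disc_ord -v3ge_logn // (disc_taylor _ _ _ s1); apply: taylor_disc_weight => //.
  - by apply: v3ge_le h0 _; nlia.
  - by apply: v3ge_le h1 _; nlia.
have h2 : v3ge (k + 2) (A s0 2) by have := A2_large_disc A2_large le; rewrite -addnA.
split=> //; split=> //.
- exact: correction_ord2 k_gt0 hs h2 y_unit s1E.
- by apply: v3ge_le h0 _; nlia.
by apply: v3ge_le h1 _; nlia.
Qed.

(** The cases (c), (d), (e) and (f). *)
Lemma s1_cases : [\/ o s1 0 = (3 * k + 1)%N,
    [/\ v3ge (3 * k + 2) (A s1 0), A s1 1 != 0 & o s1 1 = (2 * k + 1)%N],
    o s1 0 = (3 * k + 2)%N /\ v3ge (2 * k + 2) (A s1 1)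
  | v3ge (3 * k + 3) (A s1 0) /\ v3ge (2 * k + 2) (A s1 1)].
Proof.
have [hs' B0 B1 _] := s1_facts; rewrite v3ge_logn // -/(o s1 0) in B0.
have [E|N] := eqVneq (o s1 0) (3 * k + 1)%N; first by constructor 1.
have h0 : v3ge (3 * k + 2) (A s1 0) by rewrite v3ge_logn // -/(o s1 0); nlia.
have [h1|h1] := boolP (v3ge (2 * k + 2) (A s1 1)); last first.
  have A1N : A s1 1 != 0 by apply: contraNneq h1 => ->; rewrite /v3ge dvdz0.
  by constructor 2; split=> //; move: h1 B1; rewrite !v3ge_logn // -/(o s1 1); nlia.
have [E|N2] := eqVneq (o s1 0) (3 * k + 2)%N; first by constructor 3.
by constructor 4; split=> //; rewrite v3ge_logn // -/(o s1 0); nlia.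
Qed.

Lemma regular_s1_ramified m : o s1 0 = m -> ~~ (3 %| m)%N -> (m <= 3 * k + 2)%N ->
  v3ge (2 * m %/ 3 + 1) (A s1 1) -> regular f s1.
Proof.
have [hs' _ _ B2] := s1_facts; move=> o0 m3 le h1.
by apply: (regular_ramified hs' A0_s1_neq0 o0 m3 h1); apply: v3ge_le B2 _; nlia.
Qed.

Lemma regular_s1_tame : v3ge (3 * k + 2) (A s1 0) -> A s1 1 != 0 -> o s1 1 = (2 * k + 1)%N ->
  regular f s1.
Proof.
have [hs' _ _ B2] := s1_facts; move=> h0 A1N E.
by apply: (regular_tame hs' A1N E _ h0 B2); nlia.
Qed.

Lemma terminates_s1 : irregular f s1 -> iteration_terminates f s1.
Proof.
have [hs' _ B1 B2] := s1_facts; move=> irr.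
case: s1_cases => [E|[h0 A1N E]|[E h1]|[h0 h1]].
- case/negP: irr; apply: (regular_s1_ramified E); try nlia.
  by apply: v3ge_le B1 _; nlia.
- by case/negP: irr; apply: regular_s1_tame.
- case/negP: irr; apply: (regular_s1_ramified E); try nlia.
  by apply: v3ge_le h1 _; nlia.
have [st _] := steep_s1 h0 h1; exact: steep_terminates disc_neq0 disc_ord st.
Qed.

Lemma exponents_irregular : exists n1 n2, exponents f Delta u0 u1 s1 n1 n2.
Proof.
have [lt u3] := cond; case: s1_cases => [E|[h0 A1N E]|[E h1]|[h0 h1]].
- exists (2 * u0 %/ 3)%N, (u0 %/ 3)%N; apply: exponents_c => //.
  by apply/v0; rewrite E u0E.
- exists (2 * u0 %/ 3 + 1)%N, (u0 %/ 3)%N; apply: exponents_d => //.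
    by apply/g0; apply: v3ge_le h0 _; nlia.
  by apply/v1; rewrite E u0_div2.
- exists (2 * u0 %/ 3 + 1)%N, (u0 %/ 3)%N; apply: exponents_e => //.
    by apply/v0; rewrite E u0E.
  by apply/g1; rewrite u0_div2 -addnA.
have [_ le] := steep_s1 h0 h1.
exists (Delta %/ 2 - (k + 1))%N, (u0 %/ 3 + 1)%N; apply: exponents_f => //.
- by apply/g0; rewrite u0E -addnA.
- by apply/g1; rewrite u0_div2 -addnA.
by rewrite u0_div; nlia.
Qed.

Lemma basis_irregular s n1 n2 : selected f s0 s1 s ->
  exponents f Delta u0 u1 s1 n1 n2 -> basis s n1 n2.
Proof.
have irr : irregular f s0 by apply/irregular_s0P; exists k.
have [hs' B0 B1 B2] := s1_facts; have [lt u3] := cond; move=> sel.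
have sel_reg : regular f s1 -> s = s1.
  case: sel => [reg0|//|s' _ irr1 _ reg1].
    by move: irr; rewrite /irregular reg0.
  by move: irr1; rewrite /irregular reg1.
case=> {n1 n2}.
- by move=> n u1n le; move: lt; rewrite ltNge le.
- by move=> _; rewrite u3.
- move=> _ _ /v0[_ E]; rewrite u0E in E.
  have h1 : v3ge (2 * (3 * k + 1) %/ 3 + 1) (A s1 1) by apply: v3ge_le B1 _; nlia.
  rewrite sel_reg; last by apply: (regular_s1_ramified E); try nlia.
  have := @basis_ramified a b c s1 K theta f_irr f_theta K_theta (3 * k + 1) hb A0_s1_neq0.
  rewrite u0_div2 u0_div (_ : 2 * (3 * k + 1) %/ 3 = 2 * k)%N; last by nlia.
  rewrite (_ : (3 * k + 1) %/ 3 = k)%N; last by nlia.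
  by apply => //; nlia.
- move=> _ _ /g0 h0 /v1[A1N E]; have h0' : v3ge (3 * k + 2) (A s1 0) by apply: v3ge_le h0 _; nlia.
  rewrite sel_reg; last by apply: regular_s1_tame; rewrite ?E ?u0_div2.
  have := @basis_tame a b c s1 K theta f_irr f_theta K_theta (2 * k + 1) (3 * k + 2) (k + 1) hs'.
  rewrite u0_div2 u0_div (_ : (2 * k + 1) %/ 2 = k)%N; last by nlia.
  by apply => //; try nlia; rewrite -u0_div2 -E.
- move=> _ _ /v0[_ E] /g1 h1; rewrite u0E in E.
  have h1' : v3ge (2 * (3 * k + 2) %/ 3 + 1) (A s1 1) by apply: v3ge_le h1 _; nlia.
  rewrite sel_reg; last by apply: (regular_s1_ramified E); try nlia.
  have := @basis_ramified a b c s1 K theta f_irr f_theta K_theta (3 * k + 2) hb A0_s1_neq0.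
  rewrite u0_div2 u0_div (_ : 2 * (3 * k + 2) %/ 3 = 2 * k + 1)%N; last by nlia.
  rewrite (_ : (3 * k + 2) %/ 3 = k)%N; last by nlia.
  apply => //; first by nlia.
  by apply: v3ge_le h1' _; nlia.
move=> n _ _ /g0 h0 /g1 h1 En.
have [|| st le] := steep_s1.
- by apply: v3ge_le h0 _; nlia.
- by apply: v3ge_le h1 _; nlia.
have [reg' [m' st']] : regular f s /\ exists m', steep a b c (k + 1) m' s.
  case: sel {sel_reg} => [reg0|_ reg'|s' _ _ it].
  - by move: irr; rewrite /irregular reg0.
  - by split=> //; exists (2 * (k + 1))%N.
  exact: steep_iteration it st.
have k1 : (0 < k + 1)%N by nlia.
have [m ED stm] := steep_regular_max k1 disc_neq0 disc_ord st' reg'.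
have := basis_steep f_irr f_theta K_theta stm ED disc_neq0 disc_ord.
by rewrite -En u0_div (_ : n + k + 1 - (k + 1) = n)%N //; nlia.
Qed.
End IrregularStart.
End Main.

Theorem lemma4p3 (a b c : int) (f : {poly int})
    (K : fieldExtType rat) (theta : K)
    (Delta u0 : nat) (u1 : \bar rat) (s0 sigma0 y s1 : int)
    (hf : f = 'X^4 + a%:P * 'X^2 + b%:P * 'X + c%:P)
    (f_irr : irreducible_poly (map_poly intr f : {poly rat}))
    (f_theta : root (map_poly intr f) theta)
    (K_theta : <<1%VS; theta>>%VS = fullv)
    (hDelta : v3 (disc f) = Delta%:R%:E)
    (ha : (a = 3 %[mod 9])%Z) (hb : ~~ (3 %| b)%Z) (hc : (3 %| c)%Z)
    (hs0 : ((Delta%:R / 6%:R)%:E < v3 (a + 6 * s0 ^+ 2))%E)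
    (hs0b : (s0 = - b %[mod 3])%Z)
    (hu0 : v3 f.[s0] = u0%:R%:E)
    (hu1 : v3 f^`().[s0] = u1)
    (hsigma0 : f.[s0] = sigma0 * 3 ^+ u0)
    (hy : y = if (sigma0 == b %[mod 3])%Z then 1 else -1)
    (hs1 : s1 = s0 + y * 3 ^+ (u0 %/ 3)) :
  (irregular f s0 <-> ((2 * u0)%:R%:E < 3%:R%:E * u1)%E /\ (3 %| u0)%N) /\
  (irregular f s0 -> irregular f s1 -> iteration_terminates f s1) /\
  (exists nu1 nu2 : nat, exponents f Delta u0 u1 s1 nu1 nu2) /\
  (forall (s : int) (nu1 nu2 : nat),
     selected f s0 s1 s -> exponents f Delta u0 u1 s1 nu1 nu2 ->
     integral_basis3
       [tuple 1; theta;
          (theta ^+ 2 + (2 * s)%:~R * theta + (3 * s ^+ 2 + a)%:~R)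
            / 3%:R ^+ nu2;
          (theta ^+ 3 + s%:~R * theta ^+ 2 + (s ^+ 2 + a)%:~R * theta
             + (s ^+ 3 + a * s + b)%:~R) / 3%:R ^+ nu1]).
Proof.
have Ef : f = quartic a b c by [].
clear hf; subst f u1; move: hDelta; rewrite disc_quartic => /v3_eq[dN dD].
have a3 : (3 %| a)%Z by lia.
have [q s0E] : exists q, s0 = - b + 3 * q by exists ((s0 + b) %/ 3)%Z; lia.
have hs : ~~ (3 %| s0)%Z by rewrite s0E; lia.
have s0b : (3 %| s0 ^+ 3 + b)%Z.
  rewrite (_ : s0 ^+ 3 + b = (s0 ^+ 3 - s0) + 3 * q); last by rewrite s0E; ring.
  by rewrite rpredD ?cube_mod3 // dvdz_mulr.
have hA0 : v3ge 1 (taylor_coef (quartic a b c) s0 0).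
  rewrite taylor_coef_quartic /= /v3ge expr1.
  rewrite (_ : _ + c = s0 * (s0 ^+ 3 + b) + a * s0 ^+ 2 + c); last by ring.
  by apply: rpredD => //; apply: rpredD; [apply: dvdz_mull | apply: dvdz_mulr].
have A2L : taylor_coef (quartic a b c) s0 2 != 0 ->
    (Delta < 6 * ordinate (quartic a b c) s0 2)%N.
  rewrite /ordinate taylor_coef_quartic /= [6 * _ + a]addrC.
  exact: (v3_gt_div _ _).1 hs0.
move: hu0; rewrite -taylor_coef0 => /v3_eq[A0N o0].
have sigmaE : taylor_coef (quartic a b c) s0 0 = sigma0 * 3 ^+ u0 by rewrite taylor_coef0.
have sigma_unit : ~~ (3 %| sigma0)%Z.
  apply/negP => h; have : v3ge (u0 + 1) (taylor_coef (quartic a b c) s0 0).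
    by rewrite sigmaE mulrC v3ge_split.
  by rewrite v3ge_logn // o0 addn1 ltnn.
have y_unit : y = 1 \/ y = -1 by rewrite hy; case: ifP; [left | right].
have y_root : (3 %| sigma0 + s0 * y)%Z by rewrite hy; apply: sign_root sigma_unit s0E.
have hA1 : v3ge 1 (taylor_coef (quartic a b c) s0 1).
  rewrite taylor_coef_quartic /= /v3ge expr1.
  rewrite (_ : _ + b = (s0 ^+ 3 + b) + a * (2 * s0) + 3 * s0 ^+ 3); last by ring.
  by apply: rpredD; [apply: rpredD => //|]; apply: dvdz_mulr.
have irrP := irregular_s0P dN dD hs A2L A0N o0 hA0.
split; first by rewrite irrP below_u1_dvd3.
have [reg|irr] := boolP (regular (quartic a b c) s0).
  split; first by rewrite /irregular reg.
  split; first exact: (exponents_regular s1 dN dD hs A2L A0N o0 hA0 reg).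
  move=> s n1 n2 [_|irr|s' irr]; try by rewrite /irregular reg in irr.
  exact: (basis_regular f_irr f_theta K_theta dN dD hb hs A2L A0N o0 hA0 hA1 reg).
have [k u0E A1k] := irrP.1 irr; split=> [_|].
  exact: (terminates_s1 f_irr dN dD hs A2L A0N o0 hA0 sigmaE y_unit y_root hs1 u0E A1k).
split; first exact: (exponents_irregular f_irr dN dD hs A2L A0N o0 hA0 sigmaE y_unit y_root hs1 u0E A1k).
move=> s n1 n2.
exact: (basis_irregular f_irr f_theta K_theta dN dD hb hs A2L A0N o0 hA0 sigmaE y_unit y_root hs1 u0E A1k).
Qed.
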